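(* Let the data of the forward linear-quadratic problem, Problem (FLQ), be as in the context, and assume: (i) $M$ is positive definite; (ii) for every $(\omega,k)\in\Omega\times\mathbb T_\infty$, $Q_k$ is nonnegative definite, and $Q_0=0$; (iii) there is a constant $\delta>0$ such that $R_k-\delta I_m\ge0$ for every $(\omega,k)\in\Omega\times\mathbb T_\infty$; (iv) $\rho>\ln\big(6(\|A(\cdot)\|_\infty+\|C(\cdot)\|_\infty)^2\big)$. Then the Hamiltonian system $$\begin{cases}\bar x_{k+1}=A_k\bar x_k+B_k\bar u_k+b_k+(C_k\bar x_k+D_k\bar u_k+\sigma_k)w_k,\\ \bar y_k=e^{-\rho}A_k^\top\bar y'_{k+1}+e^{-\rho}C_k^\top\bar z'_{k+1}+Q_k\bar x_k,\qquad k\in\mathbb T_\infty,\\ \bar x_0=-M^{-1}\bar y_0,\\ 0=e^{-\rho}B_k^\top\bar y'_{k+1}+e^{-\rho}D_k^\top\bar z'_{k+1}+R_k\bar u_k,\end{cases}$$ where $\bar y'_{k+1}=\mathbb E[\bar y_{k+1}|\mathcal F_{k-1}]$ and $\bar z'_{k+1}=\mathbb E[\bar y_{k+1}w_k|\mathcal F_{k-1}]$, admits a unique solution $(\bar x(\cdot),\bar y(\cdot))\in N^{2,\rho}(\mathbb T_\infty;\mathbb R^{2n})$. Moreover, $$\bar\xi=-M^{-1}\bar y_0$$ is the unique optimal initial state and $$\bar u_k=-R_k^{-1}\big(e^{-\rho}B_k^\top\bar y'_{k+1}+e^{-\rho}D_k^\top\bar z'_{k+1}\big),\quad k\in\mathbb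 T_\infty,$$ is the unique optimal control of Problem (FLQ).
   Context: $\mathbb T_\infty=\{0,1,2,\dots\}$. $(\Omega,\mathcal F,\mathbb F,\mathbb P)$ is a complete filtered probability space carrying a real-valued martingale difference sequence $\{w_k\}_{k\in\mathbb T_\infty}$; $\mathcal F_k$ is the $\sigma$-algebra generated by $x_0,w_0,\dots,w_k$ for $k\ge0$, $\mathcal F_{-1}=\{\emptyset,\Omega\}$ (so initial states are deterministic), and $\mathbb E[w_{k+1}|\mathcal F_k]=0$, $\mathbb E[w_{k+1}^2|\mathcal F_k]=1$ for all $k\ge-1$. For a Euclidean space $\mathbb H$, $L^{2,\rho}_{\mathbb F}(\mathbb T_\infty;\mathbb H)$ is the set of $\mathbb H$-valued processes $g=(g_0,g_1,\dots)$ with $g_k$ $\mathcal F_{k-1}$-measurable for every $k$ and $\mathbb E\sum_{k=0}^\infty e^{-\rho k}|g_k|^2<\infty$; $L^\infty_{\mathbb F}(\mathbb T_\infty;\mathbb H)$ is the set of essentially bounded (uniformly in $k,\omega$) processes $h$ with $h_k$ $\mathcal F_{k-1}$-measurable, with norm $\|h\|_\infty=\sup_k\operatorname{ess\,sup}_\omega|h_k|$; matrices carry the norm $|A|=\sqrt{\operatorname{tr}(AA^\top)}$. $N^{2,\rho}(\mathbb T_\infty;\mathbb R^{2n})=L^{2,\rho}_{\mathbb F}(\mathbb T_\infty;\mathbb R^n)^2$. $L^2_{\mathcal F_{-1}}(\Omega;\mathbb R^n)$ is the set of square-integrable $\mathcal F_{-1}$-measurable random vectors. $\mathbb S^n$ is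 the set of symmetric $n\times n$ real matrices. $\mathbb U=L^{2,\rho}_{\mathbb F}(\mathbb T_\infty;\mathbb R^m)$ is the set of admissible controls. Data: $A(\cdot),C(\cdot)\in L^\infty_{\mathbb F}(\mathbb T_\infty;\mathbb R^{n\times n})$, $B(\cdot),D(\cdot)\in L^\infty_{\mathbb F}(\mathbb T_\infty;\mathbb R^{n\times m})$, $b(\cdot),\sigma(\cdot)\in L^{2,\rho}_{\mathbb F}(\mathbb T_\infty;\mathbb R^n)$, $M\in\mathbb S^n$, $Q(\cdot)\in L^\infty_{\mathbb F}(\mathbb T_\infty;\mathbb S^n)$, $R(\cdot)\in L^\infty_{\mathbb F}(\mathbb T_\infty;\mathbb S^m)$. State equation: for $\xi\in L^2_{\mathcal F_{-1}}(\Omega;\mathbb R^n)$ and $u(\cdot)\in\mathbb U$, $$x_{k+1}=A_kx_k+B_ku_k+b_k+(C_kx_k+D_ku_k+\sigma_k)w_k,\ k\in\mathbb T_\infty,\qquad x_0=\xi,$$ which under the condition on $\rho$ has a unique solution $x(\cdot)\in L^{2,\rho}_{\mathbb F}(\mathbb T_\infty;\mathbb R^n)$. Cost: $J(0;\xi,u(\cdot))=\frac12\mathbb E\big\{\langle M\xi,\xi\rangle+\sum_{k=0}^\infty e^{-\rho k}[\langle Q_kx_k,x_k\rangle+\langle R_ku_k,u_k\rangle]\big\}$. Problem (FLQ): find $(\bar\xi,\bar u(\cdot))\in L^2_{\mathcal F_{-1}}(\Omega;\mathbb R^n)\times\mathbb U$ minimizing $J(0;\xi,u(\cdot))$ over $L^2_{\mathcal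 F_{-1}}(\Omega;\mathbb R^n)\times\mathbb U$; such $\bar\xi$ and $\bar u(\cdot)$ are called an optimal initial state and an optimal control. *)

(* Defs.v *)
From HB Require Import structures.
From mathcomp Require Import all_boot all_order all_algebra.
From mathcomp Require Import all_classical all_reals all_analysis.
From mathcomp Require Import ess_sup_inf.

Set Implicit Arguments.
Unset Strict Implicit.
Unset Printing Implicit Defensive.

Import Order.TTheory GRing.Theory Num.Theory.
Import numFieldNormedType.Exports.

Local Open Scope classical_set_scope.
Local Open Scope ring_scope.

Definition dotv (R : realType) (n : nat) (u v : 'cV[R]_n) : R :=
  (u^T *m v) ord0 ord0.

(* On column vectors this is the Euclidean norm. *)
Definition mxnorm (R : realType) (p q : nat) (A : 'M[R]_(p, q)) : R :=
  Num.sqrt (\tr (A *m A^T)).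

Definition nonneg_definite (R : realType) (n : nat) (S : 'M[R]_n) : Prop :=
  forall v : 'cV[R]_n, 0 <= dotv (S *m v) v.

Definition pos_definite (R : realType) (n : nat) (S : 'M[R]_n) : Prop :=
  forall v : 'cV[R]_n, v != 0 -> 0 < dotv (S *m v) v.

Section Processes.
Context {d : measure_display} {T : measurableType d} {R : realType}.
Variable P : probability T R.

(* [past w k] is F_{k-1}, the sigma-algebra generated by w_0, ..., w_{k-1}.
   The index is shifted so that it starts at F_{-1} = {set0, setT}.  The initial
   state is F_{-1}-measurable, hence constant, and generates nothing more. *)
Definition past (w : nat -> T -> R) (k : nat) : set (set T) :=
  g_sigma_preimage (fun i : 'I_k => w i).

Lemma past0 (w : nat -> T -> R) : past w 0 = [set set0; setT].
Proof.
rewrite /past /g_sigma_preimage big_ord0; apply/seteqP; split.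
  apply: (@smallest_sub _ (sigma_algebra setT)) => //; split.
  - by left.
  - by move=> A [->|->]; [right; rewrite setD0|left; rewrite setDv].
  - move=> F hF; have [[i Fi]|nF] := pselect (exists i, F i = setT).
      by right; apply/seteqP; split=> // x _; exists i; rewrite ?Fi.
    left; apply/seteqP; split=> // x [i _].
    by have [->|Fi] := hF i; last by case: nF; exists i.
move=> A [->|->]; first exact: (@sigma_algebra0 _ setT).
have := sigma_algebraCD (@sigma_algebra0 T setT set0).
by rewrite setD0.
Qed.

Definition measurable_wrt (G : set (set T)) (f : T -> R) : Prop :=
  measurable_fun [set: g_sigma_algebraType G] (f : g_sigma_algebraType G -> R).

(* g is a version of E[f | G]. *)
Definition is_condexp (G : set (set T)) (f g : T -> R) : Prop :=
  [/\ P.-integrable setT (EFin \o f), P.-integrable setT (EFin \o g),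
      measurable_wrt G g &
      forall A, <<s G >> A ->
        (\int[P]_(x in A) (g x)%:E = \int[P]_(x in A) (f x)%:E)%E].

(* A chosen version of E[f | G]; junk value 0 if f has no such version. *)
Definition condexp (G : set (set T)) (f : T -> R) : T -> R :=
  xget (cst 0) [set g | is_condexp G f g].

Definition condexp_mx (p q : nat) (G : set (set T)) (X : T -> 'M[R]_(p, q)) :
    T -> 'M[R]_(p, q) :=
  fun t => \matrix_(i, j) condexp G (fun s => X s i j) t.

Definition normalized_martingale_difference (w : nat -> T -> R) : Prop :=
  [/\ forall k, measurable_fun setT (w k),
      forall k, is_condexp (past w k) (w k) (cst 0) &
      forall k, is_condexp (past w k) (fun t => w k t ^+ 2) (cst 1)].

Definition measurable_mx (p q : nat) (G : set (set T)) (X : T -> 'M[R]_(p, q)) :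
    Prop :=
  forall i j, measurable_wrt G (fun t => X t i j).

Definition predictable (p q : nat) (w : nat -> T -> R)
    (X : nat -> T -> 'M[R]_(p, q)) : Prop :=
  forall k, measurable_mx (past w k) (X k).

Definition discount (rho : R) (k : nat) : R := expR (- (rho * k%:R)).

Definition L2rho (p q : nat) (w : nat -> T -> R) (rho : R)
    (g : nat -> T -> 'M[R]_(p, q)) : Prop :=
  predictable w g /\
  (\int[P]_t (\sum_(0 <= k <oo) (discount rho k * mxnorm (g k t) ^+ 2)%:E)
     < +oo)%E.

Definition Linf_norm (p q : nat) (h : nat -> T -> 'M[R]_(p, q)) : \bar R :=
  ereal_sup [set ess_sup P (fun t => (mxnorm (h k t))%:E) | k in [set: nat]].

Definition Linf (p q : nat) (w : nat -> T -> R)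
    (h : nat -> T -> 'M[R]_(p, q)) : Prop :=
  predictable w h /\ (Linf_norm h < +oo)%E.

Definition L2_init (n : nat) (w : nat -> T -> R) (xi : T -> 'cV[R]_n) : Prop :=
  measurable_mx (past w 0) xi /\
  (\int[P]_t (mxnorm (xi t) ^+ 2)%:E < +oo)%E.

Definition ae_same (U : Type) (f g : T -> U) : Prop :=
  \forall t \ae P, f t = g t.

End Processes.

Record flq_data (T : Type) (R : realType) (n m : nat) := FLQ {
  lqA : nat -> T -> 'M[R]_n;
  lqB : nat -> T -> 'M[R]_(n, m);
  lqC : nat -> T -> 'M[R]_n;
  lqD : nat -> T -> 'M[R]_(n, m);
  lqb : nat -> T -> 'cV[R]_n;
  lqsigma : nat -> T -> 'cV[R]_n;
  lqM : 'M[R]_n;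
  lqQ : nat -> T -> 'M[R]_n;
  lqR : nat -> T -> 'M[R]_m
}.

Section Problem.
Context {d : measure_display} {T : measurableType d} {R : realType}.
Variables (P : probability T R) (w : nat -> T -> R) (rho : R).
Variables (n m : nat) (dat : flq_data T R n m).

Definition flq_admissible_data : Prop :=
  [/\ [/\ Linf P w (lqA dat), Linf P w (lqC dat),
          Linf P w (lqB dat) & Linf P w (lqD dat)],
      L2rho P w rho (lqb dat) /\ L2rho P w rho (lqsigma dat),
      lqM dat \is symmetricmx,
      Linf P w (lqQ dat) /\ (forall k t, lqQ dat k t \is symmetricmx) &
      Linf P w (lqR dat) /\ (forall k t, lqR dat k t \is symmetricmx)].

Definition next_state (k : nat) (x : T -> 'cV[R]_n) (u : T -> 'cV[R]_m) :
    T -> 'cV[R]_n :=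
  fun t =>
    lqA dat k t *m x t + lqB dat k t *m u t + lqb dat k t
    + w k t *: (lqC dat k t *m x t + lqD dat k t *m u t + lqsigma dat k t).

Fixpoint state (xi : T -> 'cV[R]_n) (u : nat -> T -> 'cV[R]_m) (k : nat) :
    T -> 'cV[R]_n :=
  if k is j.+1 then next_state j (state xi u j) (u j) else xi.

(* Under nonnegative definiteness of the weights all terms are nonnegative, so
   the extended-real limit and integral are unconditional. *)
Definition cost (xi : T -> 'cV[R]_n) (u : nat -> T -> 'cV[R]_m) : \bar R :=
  ((2^-1)%:E * \int[P]_t
    ((dotv (lqM dat *m xi t) (xi t))%:E
     + \sum_(0 <= k <oo)
        (discount rho k *
          (dotv (lqQ dat k t *m state xi u k t) (state xi u k t)
           + dotv (lqR dat k t *m u k t) (u k t)))%:E))%E.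

Definition admissible (xi : T -> 'cV[R]_n) (u : nat -> T -> 'cV[R]_m) : Prop :=
  L2_init P w xi /\ L2rho P w rho u.

Definition flq_optimal (xi : T -> 'cV[R]_n) (u : nat -> T -> 'cV[R]_m) : Prop :=
  admissible xi u /\
  forall xi' u', admissible xi' u' -> (cost xi u <= cost xi' u')%E.

(* With the shifted filtration, yprime y k is y'_{k+1} = E[y_{k+1} | F_{k-1}]
   and zprime y k is z'_{k+1} = E[y_{k+1} w_k | F_{k-1}]. *)
Definition yprime (y : nat -> T -> 'cV[R]_n) (k : nat) : T -> 'cV[R]_n :=
  condexp_mx P (past w k) (y k.+1).

Definition zprime (y : nat -> T -> 'cV[R]_n) (k : nat) : T -> 'cV[R]_n :=
  condexp_mx P (past w k) (fun t => w k t *: y k.+1 t).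

(* The equations hold almost surely, for each k.  No adaptedness is asked of u:
   the last equation determines it almost surely when the lqR are invertible. *)
Definition hamiltonian_system (x : nat -> T -> 'cV[R]_n)
    (u : nat -> T -> 'cV[R]_m) (y : nat -> T -> 'cV[R]_n) : Prop :=
  [/\ forall k, ae_same P (x k.+1) (next_state k (x k) (u k)),
      forall k, ae_same P (y k) (fun t =>
        expR (- rho) *: ((lqA dat k t)^T *m yprime y k t)
        + expR (- rho) *: ((lqC dat k t)^T *m zprime y k t)
        + lqQ dat k t *m x k t),
      ae_same P (x 0%N) (fun t => - (invmx (lqM dat) *m y 0%N t)) &
      forall k, ae_same P (fun=> 0) (fun t =>
        expR (- rho) *: ((lqB dat k t)^T *m yprime y k t)
        + expR (- rho) *: ((lqD dat k t)^T *m zprime y k t)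
        + lqR dat k t *m u k t)].

Definition xi_bar (y : nat -> T -> 'cV[R]_n) : T -> 'cV[R]_n :=
  fun t => - (invmx (lqM dat) *m y 0%N t).

Definition u_bar (y : nat -> T -> 'cV[R]_n) (k : nat) : T -> 'cV[R]_m :=
  fun t => - (invmx (lqR dat k t) *m
    (expR (- rho) *: ((lqB dat k t)^T *m yprime y k t)
     + expR (- rho) *: ((lqD dat k t)^T *m zprime y k t))).

Definition N2rho (x y : nat -> T -> 'cV[R]_n) : Prop :=
  L2rho P w rho x /\ L2rho P w rho y.

End Problem.

(* Main.v *)
Require Import Defs.
From HB Require Import structures.
From mathcomp Require Import all_boot all_order all_algebra.
From mathcomp Require Import all_classical all_reals all_analysis.
From mathcomp Require Import ess_sup_inf measurable_realfun ring lra.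

(** The cost is a quadratic functional of the plan, the pair formed by an
    initial state and a control, and its second variation [energy] is coercive
    because [M] and the [R_k] are. An optimal plan is therefore a stationary
    plan, it exists and is unique by the representation of bounded functionals
    on a complete quadratic space, [riesz_representation], and the Hamiltonian
    system is the stationarity condition with the state eliminated by duality.

    The duality is carried by one operator. For coefficients [F] and [H] let
    [shift_step F H] send [v] to the process [F v + w H v] delayed by one
    instant. Because the increments [w k] are conditionally centred and
    normalized, the two parts are orthogonal and the multiplication by [w k] is
    isometric, so the operator is bounded on the discounted space of predictable
    processes. Its adjoint is
    [y |-> e^-rho (F^T E[y_{k+1} | F_{k-1}] + H^T E[w_k y_{k+1} | F_{k-1}])]
    ([shift_duality]). With [(A, C)] for [(F, H)] this is the operator of the
    backward equation, with [(B, D)] it is the one of the optimality condition.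

    The lower bound on [rho] makes [shift_step A C] a contraction, so that
    [x = g + shift_step A C x] is solved by a bounded linear map of the source
    [g] ([solution_L2p]). The backward equation [y = shift_adj A C y + f] is then
    solved by transposition: [y] represents the bounded functional
    [g |-> <f, solution g>] ([adjoint_exists]), and conversely every solution
    represents it ([adjoint_duality]). Applied to the response to a plan and to
    [f = Q x], this rewrites the first variation of the cost as
    [<M xi + y_0, eta> + <R u + shift_adj B D y, v>] in the direction
    [(eta, v)] ([first_variation]). It vanishes in all directions if and only if
    the two remaining equations of the Hamiltonian system hold almost surely
    ([hamiltonian_stationary], [hamiltonian_exists]). Optimality and its
    uniqueness follow since at a stationary plan the cost exceeds its value
    there by half the energy of the displacement ([cost_expansion]).

    Conditional expectations come from the same representation theorem, used in
    the space of square-integrable vectors measurable for a sub-sigma-algebra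
    ([condexp_mx_spec]); its completeness, and that of the space of processes,
    are [L2v_complete] and [L2p_complete]. *)

Set Implicit Arguments.
Unset Strict Implicit.
Unset Printing Implicit Defensive.

Import Order.TTheory GRing.Theory Num.Theory.
Import numFieldNormedType.Exports.

Local Open Scope classical_set_scope.
Local Open Scope ring_scope.

(** * Representation of bounded linear functionals *)

Section Riesz.
Context {R : realType} {V : lmodType R}.
Variables (S : V -> Prop) (a : V -> V -> R) (l : V -> R) (K : R).
Hypothesis S0 : S 0.
Hypothesis S_lin : forall c u v, S u -> S v -> S (c *: u + v).
Hypothesis aC : forall u v, S u -> S v -> a u v = a v u.
Hypothesis a_lin : forall c u v h, S u -> S v -> S h ->
  a (c *: u + v) h = c * a u h + a v h.
Hypothesis a_ge0 : forall u, S u -> 0 <= a u u.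
(* Completeness is asked of sequences with a geometric rate only, and up to a
   constant: minimizing sequences can be chosen that fast, and this form passes
   between equivalent quadratic forms. *)
Hypothesis a_complete : forall s : nat -> V, (forall i, S (s i)) ->
  (forall i j, (i <= j)%N -> a (s i - s j) (s i - s j) <= 1 / 4 ^+ i) ->
  exists2 v, S v & exists C, forall i, a (s i - v) (s i - v) <= C / 4 ^+ i.
Hypothesis l_lin : forall c u v, S u -> S v -> l (c *: u + v) = c * l u + l v.
Hypothesis l_bnd : forall v, S v -> l v ^+ 2 <= K * a v v.

Lemma closed_sub u v : S u -> S v -> S (u - v).
Proof. by move=> Su Sv; rewrite addrC -scaleN1r; exact: S_lin. Qed.

Lemma form_cauchy_schwarz u v : S u -> S v -> a u v ^+ 2 <= a u u * a v v.
Proof.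
move=> Su Sv.
have q t : 0 <= a u u * t ^+ 2 + 2 * a u v * t + a v v.
  have Stu := S_lin t Su Sv.
  have := a_ge0 Stu; rewrite a_lin // aC // (aC Sv) //.
  rewrite !a_lin // (aC Sv Su); lra.
have auu := a_ge0 Su.
(* If [a u u = 0], the polynomial is affine, and bounded below only if
   [a u v = 0]. *)
have [a0|an0] := eqVneq (a u u) 0.
  have [->|uv0] := eqVneq (a u v) 0; first by rewrite a0 expr0n mul0r.
  have := q (- (a v v + 1) / (2 * a u v)).
  rewrite a0 mul0r add0r.
  have -> : 2 * a u v * (- (a v v + 1) / (2 * a u v)) = - (a v v + 1).
    by field.
  lra.
have apos : 0 < a u u by rewrite lt_neqAle eq_sym an0.
have := q (- a u v / a u u).
have -> : a u u * (- a u v / a u u) ^+ 2 + 2 * a u v * (- a u v / a u u) + a v v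
   = (a u u * a v v - a u v ^+ 2) / a u u by field.
by rewrite pmulr_lge0 ?invr_gt0 // subr_ge0.
Qed.

Let Phi v := a v v - 2 * l v.

Let Phi_step t u h : S u -> S h ->
  Phi (t *: h + u) = Phi u + 2 * t * (a u h - l h) + t ^+ 2 * a h h.
Proof.
move=> Su Sh; have Sw := S_lin t Sh Su.
rewrite /Phi a_lin // aC // (aC Su) // !a_lin // l_lin // (aC Sh Su).
ring.
Qed.

Let Phi_lb v : S v -> - `|K| <= Phi v.
Proof.
move=> Sv; rewrite /Phi.
have av := a_ge0 Sv.
have lb : l v ^+ 2 <= `|K| * a v v.
  by apply: le_trans (l_bnd Sv) _; rewrite ler_wpM2r // ler_norm.
have K0 : 0 <= `|K| by [].
suff : 2 * l v <= `|K| + a v v by lra.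
have [l0|l0] := leP (l v) 0; first by lra.
rewrite -(@ler_pXn2r _ 2) ?nnegrE ?addr_ge0 ?mulr_ge0 //; last exact: ltW.
have := sqr_ge0 (`|K| - a v v); nra.
Qed.

Let I := [set Phi v | v in S].

Let I_inf : has_inf I.
Proof.
split; first by exists (Phi 0), 0.
by exists (- `|K|) => _ [v Sv <-]; exact: Phi_lb.
Qed.

Let minimizing (i : nat) :
  exists v, S v /\ Phi v <= inf I + 4^-1 / 4 ^+ i.
Proof.
have e0 : 0 < 4^-1 / 4 ^+ i :> R by rewrite divr_gt0 // exprn_gt0.
have [_ [v Sv <-] /ltW h] := inf_adherent e0 I_inf.
by exists v.
Qed.

(** Along a minimizing sequence of [a v v - 2 * l v] the parallelogram law
    gives the Cauchy property, and the first variation at each step is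
    controlled by the distance to the infimum, so it vanishes in the limit. *)
Lemma riesz_representation : exists2 v, S v & forall h, S h -> a v h = l h.
Proof.
have [s sP] := choice minimizing.
have Ss i : S (s i) by case: (sP i).
have Phis i : Phi (s i) <= inf I + 4^-1 / 4 ^+ i by case: (sP i).
have infle v : S v -> inf I <= Phi v.
  by move=> Sv; apply: ge_inf; [case: I_inf|exists v].
have cauchy i j : (i <= j)%N ->
    a (s i - s j) (s i - s j) <= 1 / 4 ^+ i.
  move=> ij.
  have Sd := closed_sub (Ss i) (Ss j).
  (* The value at the midpoint of [s i] and [s j] is at least the infimum. *)
  have := infle _ (S_lin (- 2^-1) Sd (Ss i)).
  rewrite (Phi_step _ (Ss i) Sd).
  have := Phi_step (-1) (Ss i) Sd.
  have -> : -1 *: (s i - s j) + s i = s j.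
    by rewrite scaleN1r opprB addrNK.
  have le4 : 4^-1 / 4 ^+ j <= 4^-1 / 4 ^+ i :> R.
    by rewrite ler_wpM2l // lef_pV2 ?posrE ?exprn_gt0 // ler_eXn2l // ltr1n.
  have := Phis i; have := Phis j; move: le4.
  set q := a (s i - s j) (s i - s j); set b := a (s i) (s i - s j) - _.
  move: (4 ^+ j)^-1 (4 ^+ i)^-1 => yj yi le4 hj hi.
  have -> : (-1) ^+ 2 * q = q by ring.
  have -> : (- 2^-1) ^+ 2 * q = 4^-1 * q by field.
  lra.
have [v Sv [C vC]] := a_complete Ss cauchy.
exists v => // h Sh.
have ahh := a_ge0 Sh.
(* The derivative at [s i] in the direction [h], estimated by one step of
   optimal length; [a h h + 1] replaces [a h h] to allow for null directions. *)
have est i : (a (s i) h - l h) ^+ 2 <= 4^-1 / 4 ^+ i * (a h h + 1).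
  set x := a (s i) h - l h.
  have ah1 : 0 < a h h + 1 by lra.
  have := infle _ (S_lin (- x / (a h h + 1)) Sh (Ss i)).
  rewrite (Phi_step _ (Ss i) Sh) -/x.
  have := Phis i.
  set y := _ / _ => h1 h2.
  have h3 : 0 <= y + 2 * (- x / (a h h + 1)) * x + (- x / (a h h + 1)) ^+ 2 * (a h h + 1).
    have : (- x / (a h h + 1)) ^+ 2 * a h h <= (- x / (a h h + 1)) ^+ 2 * (a h h + 1).
      by rewrite ler_wpM2l ?sqr_ge0 // lerDl.
    lra.
  have h4 : y + 2 * (- x / (a h h + 1)) * x + (- x / (a h h + 1)) ^+ 2 * (a h h + 1)
      = y - x ^+ 2 / (a h h + 1) by field; rewrite gt_eqF.
  by rewrite h4 subr_ge0 ler_pdivrMr in h3.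
have bound i : (a v h - l h) ^+ 2 <=
    2 * (C * a h h + 4^-1 * (a h h + 1)) / 4 ^+ i.
  have Sd := closed_sub (Ss i) Sv.
  have h1 : a (s i - v) h = a (s i) h - a v h.
    have := a_lin (-1) Sv (Ss i) Sh.
    by rewrite scaleN1r addrC => ->; lra.
  have h2 : (a (s i) h - a v h) ^+ 2 <= C / 4 ^+ i * a h h.
    rewrite -h1; apply: le_trans (form_cauchy_schwarz Sd Sh) _.
    by rewrite ler_wpM2r.
  have := est i.
  set x := a (s i) h in h2 *; set y := a v h in h2 *.
  have -> : 2 * (C * a h h + 4^-1 * (a h h + 1)) / 4 ^+ i =
    2 * (C / 4 ^+ i * a h h) + 2 * (4^-1 / 4 ^+ i * (a h h + 1)) by ring.
  have := sqr_ge0 (x - y + (x - l h)); nra.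
set D := 2 * _ in bound.
apply/eqP; rewrite -subr_eq0 -sqrf_eq0 eq_le sqr_ge0 andbT.
have cv : (D / 4 ^+ i) @[i --> \oo] --> (0 : R).
  have := @cvg_geometric R D 4^-1; rewrite ger0_norm // invf_lt1 // ltr1n.
  move=> /(_ isT); apply: cvg_trans; apply: near_eq_cvg; apply: nearW => i.
  by rewrite /= exprVn.
rewrite -(cvg_lim _ cv) //; apply: limr_ge; first by apply/cvg_ex; exists 0.
by apply: nearW => i; exact: bound.
Qed.

End Riesz.

(** * Euclidean vectors and definite matrices *)

Section EuclideanVectors.
Context {R : realType} {n : nat}.
Implicit Types u v : 'cV[R]_n.

Lemma dotvE u v : dotv u v = \sum_i u i ord0 * v i ord0.
Proof. by rewrite /dotv mxE; apply: eq_bigr => i _; rewrite mxE. Qed.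

Lemma dotvC u v : dotv u v = dotv v u.
Proof. by rewrite !dotvE; apply: eq_bigr => i _; rewrite mulrC. Qed.

Lemma dotvDl u1 u2 v : dotv (u1 + u2) v = dotv u1 v + dotv u2 v.
Proof.
by rewrite !dotvE -big_split; apply: eq_bigr => i _; rewrite !mxE mulrDl.
Qed.

Lemma dotvDr u v1 v2 : dotv u (v1 + v2) = dotv u v1 + dotv u v2.
Proof. by rewrite dotvC dotvDl dotvC (dotvC v2). Qed.

Lemma dotvZl c u v : dotv (c *: u) v = c * dotv u v.
Proof.
by rewrite !dotvE mulr_sumr; apply: eq_bigr => i _; rewrite mxE mulrA.
Qed.

Lemma dotvZr c u v : dotv u (c *: v) = c * dotv u v.
Proof. by rewrite dotvC dotvZl dotvC. Qed.

Lemma dotvNl u v : dotv (- u) v = - dotv u v.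
Proof. by rewrite -scaleN1r dotvZl mulN1r. Qed.

Lemma dotvNr u v : dotv u (- v) = - dotv u v.
Proof. by rewrite dotvC dotvNl dotvC. Qed.

Lemma dotv0l v : dotv 0 v = 0.
Proof. by rewrite -(scale0r 0) dotvZl mul0r. Qed.

Lemma dotv_ge0 v : 0 <= dotv v v.
Proof. by rewrite dotvE sumr_ge0 // => i _; rewrite -expr2 sqr_ge0. Qed.

Lemma dotv_eq0 v : dotv v v = 0 -> v = 0.
Proof.
rewrite dotvE => /eqP; rewrite psumr_eq0; last first.
  by move=> i _; rewrite -expr2 sqr_ge0.
move=> /allP h; apply/colP => i; rewrite mxE.
by have := h i; rewrite mem_index_enum mulf_eq0 orbb => /(_ isT)/eqP.
Qed.

Lemma dotv_delta v i : dotv v (delta_mx i ord0) = v i ord0.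
Proof.
rewrite dotvE (bigD1 i) //= big1 ?addr0 ?mxE ?eqxx ?mulr1 // => j ji.
by rewrite mxE (negbTE ji) mulr0.
Qed.

Lemma dotv_cauchy_schwarz u v : dotv u v ^+ 2 <= dotv u u * dotv v v.
Proof.
apply: (@form_cauchy_schwarz R _ (fun=> True) (@dotv R n)) => //.
- by move=> *; exact: dotvC.
- by move=> *; rewrite dotvDl dotvZl.
- by move=> *; exact: dotv_ge0.
Qed.

End EuclideanVectors.

Lemma dotv_adj (R : realType) n m (A : 'M[R]_(n, m)) u v :
  dotv (A *m u) v = dotv u (A^T *m v).
Proof. by rewrite /dotv trmx_mul mulmxA. Qed.

Lemma dotv_sym (R : realType) n (A : 'M[R]_n) u v : A \is symmetricmx ->
  dotv (A *m u) v = dotv (A *m v) u.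
Proof.
move=> /is_hermitianmxP; rewrite expr0 scale1r map_mx_id // => E.
by rewrite dotv_adj -E dotvC.
Qed.

Lemma mxnorm_sqr (R : realType) n m (A : 'M[R]_(n, m)) :
  mxnorm A ^+ 2 = \sum_i \sum_j A i j ^+ 2.
Proof.
have E : \tr (A *m A^T) = \sum_i \sum_j A i j ^+ 2.
  rewrite /mxtrace; apply: eq_bigr => i _; rewrite mxE.
  by apply: eq_bigr => j _; rewrite mxE expr2.
rewrite /mxnorm sqr_sqrtr E // sumr_ge0 // => i _.
by rewrite sumr_ge0 // => j _; exact: sqr_ge0.
Qed.

Lemma mxnorm_ge0 (R : realType) n m (A : 'M[R]_(n, m)) : 0 <= mxnorm A.
Proof. exact: sqrtr_ge0. Qed.

Lemma mxnorm_sqr_cV (R : realType) n (v : 'cV[R]_n) :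
  mxnorm v ^+ 2 = dotv v v.
Proof.
rewrite mxnorm_sqr dotvE; apply: eq_bigr => i _.
by rewrite big_ord1 expr2.
Qed.

Lemma dotv_mulmx_le (R : realType) n m (A : 'M[R]_(n, m)) v :
  dotv (A *m v) (A *m v) <= mxnorm A ^+ 2 * dotv v v.
Proof.
rewrite mxnorm_sqr dotvE mulr_suml; apply: ler_sum => i _.
have -> : (A *m v) i ord0 = dotv (row i A)^T v.
  by rewrite dotvE mxE; apply: eq_bigr => j _; rewrite !mxE.
rewrite -expr2; apply: le_trans (dotv_cauchy_schwarz _ _) _.
rewrite ler_wpM2r ?dotv_ge0 // dotvE; apply: ler_sum => j _.
by rewrite !mxE expr2.
Qed.

Lemma dotv_mulmx_le_norm (R : realType) n (A : 'M[R]_n) v :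
  dotv (A *m v) v <= mxnorm A * dotv v v.
Proof.
have v0 := dotv_ge0 v; have A0 := mxnorm_ge0 A.
have [h|h] := leP (dotv (A *m v) v) 0.
  by apply: le_trans h _; rewrite mulr_ge0.
rewrite -(@ler_pXn2r _ 2) ?nnegrE ?mulr_ge0 //; last exact: ltW.
apply: le_trans (dotv_cauchy_schwarz _ _) _.
have := dotv_mulmx_le A v; rewrite exprMn; nra.
Qed.

Section DefiniteMatrices.
Context {R : realType} {n : nat}.
Implicit Types M : 'M[R]_n.

Lemma unitmx_of_trivial_kernel M : (forall v : 'cV_n, M *m v = 0 -> v = 0) ->
  M \in unitmx.
Proof.
move=> ker0; rewrite -unitmx_tr -row_free_unit -kermx_eq0; apply/eqP.
apply/row_matrixP => i; rewrite row0; set r := row i _.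
have rK : r *m M^T = 0.
  by apply/sub_kermxP; exact: row_sub.
have /ker0 : M *m r^T = 0 by apply: trmx_inj; rewrite trmx_mul trmxK rK trmx0.
by move/(congr1 trmx); rewrite trmxK trmx0.
Qed.

Lemma pos_definite_unitmx M : pos_definite M -> M \in unitmx.
Proof.
move=> Mpos; apply: unitmx_of_trivial_kernel => v Mv0.
apply/eqP/negPn/negP => /Mpos.
by rewrite Mv0 dotv0l ltxx.
Qed.

Lemma pos_definite_ge0 M v : pos_definite M -> 0 <= dotv (M *m v) v.
Proof.
move=> Mpos; have [->|/Mpos/ltW//] := eqVneq v 0.
by rewrite mulmx0 dotv0l.
Qed.

(** The coercivity constant comes from the Cauchy-Schwarz inequality of the
    form of [M] applied to [v] and [M^-1 v]: as [M (M^-1 v) = v], it bounds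
    [|v|^2] without any spectral decomposition. *)
Lemma pos_definite_coercive M v : M \is symmetricmx -> pos_definite M ->
  dotv v v <= mxnorm (invmx M) * dotv (M *m v) v.
Proof.
move=> Msym Mpos.
have v0 := dotv_ge0 v.
have Mv0 := pos_definite_ge0 v Mpos.
have CS := @form_cauchy_schwarz R _ (fun=> True)
  (fun x y : 'cV_n => dotv (M *m x) y).
have {CS} CS : dotv (M *m v) (invmx M *m v) ^+ 2 <=
    dotv (M *m v) v * dotv (M *m (invmx M *m v)) (invmx M *m v).
  apply: CS => //.
  - by move=> x y _ _; exact: dotv_sym.
  - by move=> c x y h _ _ _; rewrite mulmxDr -scalemxAr dotvDl dotvZl.
  - by move=> x _; exact: pos_definite_ge0.
have MK : M *m (invmx M *m v) = v by rewrite mulKVmx // pos_definite_unitmx.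
move: CS; rewrite (dotv_sym _ _ Msym) MK.
rewrite [dotv v (_ *m _)]dotvC.
have := dotv_mulmx_le_norm (invmx M) v.
have N0 := mxnorm_ge0 (invmx M).
set x := dotv v v in v0 *; set y := dotv (M *m v) v in Mv0 *.
set z := dotv (invmx M *m v) v => h1 h2.
have h3 : x * x <= (mxnorm (invmx M) * y) * x.
  rewrite -expr2; apply: le_trans h2 _.
  by rewrite -mulrA mulrCA ler_wpM2l.
have [x0|x0] := eqVneq x 0; first by rewrite x0 mulr_ge0.
by move: h3; rewrite ler_pM2r // lt_neqAle eq_sym x0.
Qed.

Lemma coercive_ge M (delta : R) v : nonneg_definite (M - delta%:M) ->
  delta * dotv v v <= dotv (M *m v) v.
Proof.
move=> /(_ v); rewrite mulmxBl dotvDl dotvNl mul_scalar_mx dotvZl.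
by rewrite subr_ge0.
Qed.

Lemma coercive_unitmx M (delta : R) : 0 < delta ->
  nonneg_definite (M - delta%:M) -> M \in unitmx.
Proof.
move=> d0 Md; apply: unitmx_of_trivial_kernel => v Mv0.
have := coercive_ge v Md; rewrite Mv0 dotv0l pmulr_rle0 // => h.
by apply: dotv_eq0; apply/eqP; rewrite eq_le h dotv_ge0.
Qed.

Lemma coercive_inv_le M (delta : R) v : 0 < delta ->
  nonneg_definite (M - delta%:M) ->
  dotv (invmx M *m v) (invmx M *m v) <= delta ^- 2 * dotv v v.
Proof.
move=> d0 Md; set u := invmx M *m v.
have Mu : M *m u = v by rewrite mulKVmx // (coercive_unitmx d0 Md).
have h1 := coercive_ge u Md; rewrite Mu in h1.
have h2 := dotv_cauchy_schwarz v u.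
have u0 := dotv_ge0 u.
rewrite mulrC ler_pdivlMr ?exprn_gt0 // mulrC.
have [U0|U0] := eqVneq (dotv u u) 0; first by rewrite U0 mulr0 dotv_ge0.
have up : 0 < dotv u u by rewrite lt_neqAle eq_sym U0.
rewrite -(ler_pM2r up); apply: le_trans h2.
rewrite -mulrA -expr2 -exprMn ler_pXn2r ?nnegrE ?mulr_ge0 // ?(ltW d0) //.
by apply: le_trans h1; rewrite mulr_ge0 // ltW.
Qed.

End DefiniteMatrices.

(** * Measurability and integrals relative to a sub-sigma-algebra *)

Section SubSigmaAlgebra.
Context {d : measure_display} {T : measurableType d} {R : realType}.
Variable P : probability T R.
Implicit Types (G : set (set T)) (f g h : T -> R).

Lemma measurable_wrtW G f : <<s G >> `<=` measurable ->
  measurable_wrt G f -> measurable_fun setT f.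
Proof.
move=> GT mf _ B mB; have := mf measurableT B mB.
by rewrite !setTI; exact: GT.
Qed.

Lemma measurable_wrt_sub G G' f : <<s G >> `<=` <<s G' >> ->
  measurable_wrt G f -> measurable_wrt G' f.
Proof.
move=> GG' mf _ B mB; have := mf measurableT B mB.
by rewrite !setTI; exact: GG'.
Qed.

Import HBNNSimple.

Let integral_simple_mul G (phi : {nnsfun (g_sigma_algebraType G) >-> R}) f :
  <<s G >> `<=` measurable ->
  measurable_fun setT f -> (forall x, 0 <= f x) ->
  (\int[P]_x (phi x * f x)%:E =
   \sum_(r \in range phi) r%:E * \int[P]_(x in phi @^-1` [set r]) (f x)%:E)%E.
Proof.
move=> GT mf f0.
have mpre r : measurable (phi @^-1` [set r] : set T).
  apply: GT; have := measurable_funPT phi measurableT _ (measurable_set1 r).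
  by rewrite setTI.
have mind r : measurable_fun setT (\1_(phi @^-1` [set r]) : T -> R).
  exact: measurable_indic.
have nng r x : 0 <= (r * \1_(phi @^-1` [set r]) x : R).
  by have := nnfun_muleindic_ge0 phi r x; rewrite -EFinM lee_fin.
transitivity (\int[P]_x (\sum_(r \in range phi)
    (r * \1_(phi @^-1` [set r]) x * f x)%:E))%E.
  apply: eq_integral => x _; rewrite fsumEFin // -mulr_fsuml.
  by rewrite -(fimfunE phi).
rewrite ge0_integral_fsum //; last 2 first.
- move=> r; apply/measurable_EFinP; apply: measurable_funM => //.
  exact: measurable_funM.
- by move=> r x _; rewrite lee_fin mulr_ge0.
apply: eq_fsbigr => r; rewrite inE => -[t _ <-].
have p0 : 0 <= phi t by [].
transitivity ((phi t)%:E *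
   \int[P]_x (\1_(phi @^-1` [set phi t]) x * f x)%:E)%E.
  rewrite -ge0_integralZl_EFin //.
  - by apply: eq_integral => x _; rewrite -EFinM mulrA.
  - by move=> x _; rewrite lee_fin mulr_ge0.
  - by apply/measurable_EFinP; exact: measurable_funM.
congr (_ * _)%E; rewrite [RHS]integral_mkcond; apply: eq_integral => x _.
by rewrite patchE indicE; case: ifP => _; rewrite /= ?mul1r ?mul0r.
Qed.

(** The two sides agree on simple functions by hypothesis, and on [h] by
    monotone convergence. *)
Lemma integral_density_sub G f1 f2 h : <<s G >> `<=` measurable ->
  measurable_fun setT f1 -> (forall x, 0 <= f1 x) ->
  measurable_fun setT f2 -> (forall x, 0 <= f2 x) ->
  (forall A, <<s G >> A ->
    (\int[P]_(x in A) (f1 x)%:E = \int[P]_(x in A) (f2 x)%:E)%E) ->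
  measurable_wrt G h -> (forall x, 0 <= h x) ->
  (\int[P]_x (h x * f1 x)%:E = \int[P]_x (h x * f2 x)%:E)%E.
Proof.
move=> GT mf1 f10 mf2 f20 f12 mh h0.
have mhE : measurable_fun [set: g_sigma_algebraType G] (EFin \o h).
  exact/measurable_EFinP.
pose phi := nnsfun_approx measurableT mhE.
have cphi x : (phi n x)%:E @[n --> \oo] --> (h x)%:E.
  by apply: (@cvg_nnsfun_approx _ _ _ _ measurableT _ mhE) => // y _;
     rewrite lee_fin.
have mono f : measurable_fun setT f -> (forall x, 0 <= f x) ->
    (\int[P]_x (phi n x * f x)%:E @[n --> \oo] -->
     \int[P]_x (h x * f x)%:E)%E.
  move=> mf f0.
  rewrite (_ : \int[P]_x (h x * f x)%:E =
     \int[P]_x (limn (fun n => (phi n x * f x)%:E)))%E; last first.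
    apply: eq_integral => x _; apply/esym/cvg_lim => //.
    rewrite EFinM; under eq_fun do rewrite EFinM.
    by apply: cvgeZr => //; exact: cphi.
  apply: cvg_monotone_convergence => //.
  - move=> n; apply/measurable_EFinP; apply: measurable_funM => //.
    by apply: (@measurable_wrtW G) => //; exact: measurable_funP.
  - by move=> n x _; rewrite lee_fin mulr_ge0.
  - move=> x _ a b ab; rewrite lee_fin ler_wpM2r //.
    by have /lefP := nd_nnsfun_approx measurableT mhE ab; exact.
rewrite -(cvg_lim _ (mono _ mf1 f10)) // -(cvg_lim _ (mono _ mf2 f20)) //.
congr (limn _); apply/funext => n; rewrite !integral_simple_mul //.
apply: eq_fsbigr => r _; rewrite f12 //.
by have := measurable_funPT (phi n) measurableT _ (measurable_set1 r); rewrite setTI.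
Qed.

End SubSigmaAlgebra.

(** * Square-integrable random vectors *)

Section SquareIntegrable.
Context {d : measure_display} {T : measurableType d} {R : realType}.
Variable P : probability T R.
Implicit Types (G : set (set T)) (n m : nat).

Definition sqint n (X : T -> 'cV[R]_n) : Prop :=
  (forall i j, measurable_fun setT (fun t => X t i j)) /\
  P.-integrable setT (fun t => (dotv (X t) (X t))%:E).

Definition L2v G n (X : T -> 'cV[R]_n) : Prop := measurable_mx G X /\ sqint X.

Definition ip n (X Y : T -> 'cV[R]_n) : R := \int[P]_t dotv (X t) (Y t).

Lemma ae_sameS U (f g : T -> U) : (forall t, f t = g t) -> ae_same P f g.
Proof. by move=> fg; apply: nearW. Qed.

Lemma ae_same_sym U (f g : T -> U) : ae_same P f g -> ae_same P g f.
Proof. by apply: filterS => t ->. Qed.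

Lemma ae_same_trans U (f g h : T -> U) :
  ae_same P f g -> ae_same P g h -> ae_same P f h.
Proof. by apply: filterS2 => t -> ->. Qed.

Lemma measurable_dotv n (X Y : T -> 'cV[R]_n) :
  (forall i j, measurable_fun setT (fun t => X t i j)) ->
  (forall i j, measurable_fun setT (fun t => Y t i j)) ->
  measurable_fun setT (fun t => dotv (X t) (Y t)).
Proof.
move=> mX mY; under eq_fun do rewrite dotvE.
by apply: measurable_sum => i; exact: measurable_funM.
Qed.

Lemma measurable_mx_dotv G n (X Y : T -> 'cV[R]_n) :
  measurable_mx G X -> measurable_mx G Y ->
  measurable_wrt G (fun t => dotv (X t) (Y t)).
Proof.
move=> mX mY; rewrite /measurable_wrt; under eq_fun do rewrite dotvE.
by apply: measurable_sum => i; apply: measurable_funM; [exact: mX|exact: mY].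
Qed.

Lemma measurable_mulmx n m (A : T -> 'M[R]_(n, m)) (X : T -> 'cV[R]_m) :
  (forall i j, measurable_fun setT (fun t => A t i j)) ->
  (forall i j, measurable_fun setT (fun t => X t i j)) ->
  forall i j, measurable_fun setT (fun t => (A t *m X t) i j).
Proof.
move=> mA mX i j; under eq_fun do rewrite mxE.
by apply: measurable_sum => k; exact: measurable_funM.
Qed.

Lemma measurable_mx_mul G n m (A : T -> 'M[R]_(n, m)) (X : T -> 'cV[R]_m) :
  measurable_mx G A -> measurable_mx G X ->
  measurable_mx G (fun t => A t *m X t).
Proof.
move=> mA mX i j; rewrite /measurable_wrt; under eq_fun do rewrite mxE.
by apply: measurable_sum => k; apply: measurable_funM; [exact: mA|exact: mX].
Qed.

Lemma measurable_mx_lin G n (X Y : T -> 'cV[R]_n) c :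
  measurable_mx G X -> measurable_mx G Y -> measurable_mx G (c *: X + Y).
Proof.
move=> mX mY i j; rewrite /measurable_wrt.
rewrite (_ : (fun t => _) = (fun t => c * X t i j + Y t i j)); last first.
  by apply/funext => t; rewrite !fctE !mxE.
apply: measurable_funD; last exact: mY.
by apply: measurable_funM; [exact: measurable_cst|exact: mX].
Qed.

Lemma measurable_mx_trmx G n m (A : T -> 'M[R]_(n, m)) :
  measurable_mx G A -> measurable_mx G (fun t => (A t)^T).
Proof.
by move=> mA i j; rewrite /measurable_wrt; under eq_fun do rewrite mxE; exact: mA.
Qed.

(** The bound is almost sure because it comes from essentially bounded matrix
    coefficients. *)
Lemma sqint_dom n m (X : T -> 'cV[R]_n) (Y : T -> 'cV[R]_m) c :
  sqint X -> (forall i j, measurable_fun setT (fun t => Y t i j)) -> 0 <= c ->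
  (\forall t \ae P, dotv (Y t) (Y t) <= c * dotv (X t) (X t)) ->
  sqint Y /\ ip Y Y <= c * ip X X.
Proof.
move=> [mX iX] mY c0 YX.
have mYY := measurable_dotv mY mY.
have mXX := measurable_dotv mX mX.
have le : (\int[P]_t (dotv (Y t) (Y t))%:E <=
           c%:E * \int[P]_t (dotv (X t) (X t))%:E)%E.
  rewrite -ge0_integralZl_EFin //; last 2 first.
  - by move=> t _; rewrite lee_fin dotv_ge0.
  - exact/measurable_EFinP.
  apply: ae_ge0_le_integral => //.
  - by move=> t _; rewrite lee_fin dotv_ge0.
  - exact/measurable_EFinP.
  - by move=> t _; rewrite lee_fin mulr_ge0 // dotv_ge0.
  - by apply/measurable_EFinP; exact: measurable_funM.
  - by apply: filterS YX => t h _; rewrite lee_fin.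
have fX := integrable_fin_num measurableT iX.
have Yoo : (\int[P]_t (dotv (Y t) (Y t))%:E < +oo)%E.
  apply: le_lt_trans le _; rewrite -(fineK fX) -EFinM ltry //.
have iY : P.-integrable setT (fun t => (dotv (Y t) (Y t))%:E).
  apply/integrableP; split; first exact/measurable_EFinP.
  under eq_integral do rewrite gee0_abs ?lee_fin ?dotv_ge0 //.
  exact: Yoo.
split; first by [].
rewrite -lee_fin EFinM /ip /Rintegral !fineK //.
exact: (integrable_fin_num measurableT iY).
Qed.

Lemma integrable_dotv n (X Y : T -> 'cV[R]_n) : sqint X -> sqint Y ->
  P.-integrable setT (fun t => (dotv (X t) (Y t))%:E).
Proof.
move=> [mX iX] [mY iY].
apply: (le_integrable _ _ _ (integrableD measurableT iX iY)) => //.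
  by apply/measurable_EFinP; exact: measurable_dotv.
move=> t _.
change (`|dotv (X t) (Y t)|%:E <= `|dotv (X t) (X t) + dotv (Y t) (Y t)|%:E)%E.
rewrite lee_fin (ger0_norm (addr_ge0 (dotv_ge0 _) (dotv_ge0 _))) ler_norml.
have := dotv_ge0 (X t + Y t); have := dotv_ge0 (X t - Y t).
have := dotv_ge0 (X t); have := dotv_ge0 (Y t).
rewrite !(dotvDl, dotvDr, dotvNl, dotvNr) (dotvC (Y t) (X t)).
by move=> *; apply/andP; split; lra.
Qed.

Lemma sqint_lin n (X Y : T -> 'cV[R]_n) c : sqint X -> sqint Y ->
  sqint (c *: X + Y).
Proof.
move=> sX sY; have [mX iX] := sX; have [mY iY] := sY.
have E t : (c *: X + Y) t = c *: X t + Y t by [].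
split.
  move=> i j; rewrite (_ : (fun t => _) = (fun t => c * X t i j + Y t i j)).
    apply: measurable_funD; last exact: mY.
    by apply: measurable_funM => //; exact: mX.
  by apply/funext => t; rewrite E !mxE.
have iXY := integrable_dotv sX sY.
have : P.-integrable setT (fun t => ((c ^+ 2)%:E * (dotv (X t) (X t))%:E) +
   ((2 * c)%:E * (dotv (X t) (Y t))%:E + (dotv (Y t) (Y t))%:E))%E.
  by apply: integrableD => //; [|apply: integrableD => //]; exact: integrableZl.
apply: eq_integrable => // t _.
rewrite E !(dotvDl, dotvDr, dotvZl, dotvZr) (dotvC (Y t) (X t)) -!EFinM -!EFinD.
by congr (_%:E); ring.
Qed.

Lemma sqint0 n : sqint (0 : T -> 'cV[R]_n).
Proof.
split.
  move=> i j; rewrite (_ : (fun t => _) = cst 0); first exact: measurable_cst.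
  by apply/funext => t; rewrite /= mxE.
under eq_fun do rewrite dotv0l; exact: integrable0.
Qed.

Lemma sqint_cst n (v : 'cV[R]_n) : sqint (fun=> v).
Proof.
split; first by move=> i j; exact: measurable_cst.
apply/integrableP; split; first exact: measurable_cst.
rewrite integral_cst // [X in (_ * X)%E](_ : _ = 1%E) ?mule1 ?ltry //.
exact: probability_setT.
Qed.

Lemma L2v_cst G n (v : 'cV[R]_n) : L2v G (fun=> v).
Proof. by split; [move=> i j; exact: measurable_cst|exact: sqint_cst]. Qed.

Lemma L2v_lin G n (X Y : T -> 'cV[R]_n) c : L2v G X -> L2v G Y ->
  L2v G (c *: X + Y).
Proof.
move=> [mX sX] [mY sY]; split; last exact: sqint_lin.
exact: measurable_mx_lin.
Qed.

Lemma L2v0 G n : L2v G (0 : T -> 'cV[R]_n).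
Proof.
split; last exact: sqint0.
move=> i j; rewrite /measurable_wrt (_ : (fun t => _) = cst 0).
  exact: measurable_cst.
by apply/funext => t; rewrite /= mxE.
Qed.

Lemma ipC n (X Y : T -> 'cV[R]_n) : ip X Y = ip Y X.
Proof. by rewrite /ip; under eq_Rintegral do rewrite dotvC. Qed.

Lemma ip_linl n (X Y Z : T -> 'cV[R]_n) c : sqint X -> sqint Y -> sqint Z ->
  ip (c *: X + Y) Z = c * ip X Z + ip Y Z.
Proof.
move=> sX sY sZ; have iX := integrable_dotv sX sZ; have iY := integrable_dotv sY sZ.
rewrite /ip; under eq_Rintegral => t _.
  rewrite (_ : (c *: X + Y) t = c *: X t + Y t) // dotvDl dotvZl; over.
rewrite RintegralD //=; first by rewrite RintegralZl.
have := integrableZl measurableT c iX.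
by apply: eq_integrable => // t _; rewrite -EFinM.
Qed.

Lemma ip_ge0 n (X : T -> 'cV[R]_n) : 0 <= ip X X.
Proof. by apply: Rintegral_ge0 => t _; exact: dotv_ge0. Qed.

Lemma ip_cauchy_schwarz n (X Y : T -> 'cV[R]_n) : sqint X -> sqint Y ->
  ip X Y ^+ 2 <= ip X X * ip Y Y.
Proof.
move=> sX sY.
apply: (@form_cauchy_schwarz R _ (@sqint n) (@ip n)) => //.
- by move=> *; exact: sqint_lin.
- by move=> *; exact: ipC.
- by move=> *; exact: ip_linl.
- by move=> *; exact: ip_ge0.
Qed.

Lemma ip_eq0 n (X : T -> 'cV[R]_n) : sqint X -> ip X X = 0 ->
  ae_same P X (fun=> 0).
Proof.
move=> [mX iX] X0.
have m2 : measurable_fun setT (fun t => (dotv (X t) (X t))%:E).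
  by apply/measurable_EFinP; exact: measurable_dotv.
have : (\int[P]_t `|(dotv (X t) (X t))%:E| = 0)%E.
  under eq_integral do rewrite gee0_abs ?lee_fin ?dotv_ge0 //.
  rewrite -[LHS]fineK; last exact: (integrable_fin_num measurableT iX).
  by rewrite -[fine _]/(ip X X) X0.
move/(ae_eq_integral_abs P measurableT m2).1.
by apply: filterS => t /(_ I) [] /dotv_eq0.
Qed.

Lemma ip_ae n (X X' Y : T -> 'cV[R]_n) : sqint X -> sqint X' -> sqint Y ->
  ae_same P X X' -> ip X Y = ip X' Y.
Proof.
move=> [mX _] [mX' _] [mY _] XX'; rewrite /ip /Rintegral; congr fine.
apply: ae_eq_integral => //.
- by apply/measurable_EFinP; exact: measurable_dotv.
- by apply/measurable_EFinP; exact: measurable_dotv.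
- by apply: filterS XX' => t ->.
Qed.

Lemma sqint_ae n (X X' : T -> 'cV[R]_n) : sqint X ->
  (forall i j, measurable_fun setT (fun t => X' t i j)) ->
  ae_same P X X' -> sqint X'.
Proof.
move=> sX mX' XX'; apply: (sqint_dom sX mX' ler01 _).1.
by apply: filterS XX' => t ->; rewrite mul1r.
Qed.

Lemma ip0l n (Y : T -> 'cV[R]_n) : ip 0 Y = 0.
Proof.
rewrite /ip; under eq_Rintegral do rewrite dotv0l.
by rewrite Rintegral_cst // mul0r.
Qed.

Lemma ipZl n (X Y : T -> 'cV[R]_n) c : sqint X -> sqint Y ->
  ip (c *: X) Y = c * ip X Y.
Proof.
move=> sX sY; have := ip_linl c sX (sqint0 n) sY.
by rewrite ip0l !addr0.
Qed.

Lemma L2vZ G n (X : T -> 'cV[R]_n) c : L2v G X -> L2v G (c *: X).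
Proof. by move=> LX; rewrite -[c *: X]addr0; apply: L2v_lin => //; exact: L2v0. Qed.

Lemma ip_adj n m (A : T -> 'M[R]_(n, m)) (X : T -> 'cV[R]_m) (Y : T -> 'cV[R]_n) :
  ip (fun t => A t *m X t) Y = ip X (fun t => (A t)^T *m Y t).
Proof. by rewrite /ip; under eq_Rintegral do rewrite dotv_adj. Qed.

Lemma sqint_mulmx n m (A : T -> 'M[R]_(n, m)) (X : T -> 'cV[R]_m) a :
  (forall i j, measurable_fun setT (fun t => A t i j)) ->
  (\forall t \ae P, mxnorm (A t) <= a) -> sqint X ->
  sqint (fun t => A t *m X t) /\
  ip (fun t => A t *m X t) (fun t => A t *m X t) <= a ^+ 2 * ip X X.
Proof.
move=> mA Aa sX; apply: sqint_dom => //; last 2 first.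
- exact: sqr_ge0.
- apply: filterS Aa => t At; apply: le_trans (dotv_mulmx_le _ _) _.
  rewrite ler_wpM2r ?dotv_ge0 // lerXn2r ?nnegrE ?mxnorm_ge0 //.
  by apply: le_trans At; exact: mxnorm_ge0.
- exact: measurable_mulmx mA sX.1.
Qed.

End SquareIntegrable.

(** * Conditionally centred and normalized increments *)

Section NormalizedIncrement.
Context {d : measure_display} {T : measurableType d} {R : realType}.
Variables (P : probability T R) (G : set (set T)) (v : T -> R).
Hypothesis GT : <<s G >> `<=` measurable.
Hypothesis mv : measurable_fun setT v.
Hypothesis v_mean : is_condexp P G v (cst 0).
Hypothesis v_var : is_condexp P G (fun t => v t ^+ 2) (cst 1).

Lemma measurable_scalev n (X : T -> 'cV[R]_n) :
  (forall i j, measurable_fun setT (fun t => X t i j)) ->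
  forall i j, measurable_fun setT (fun t => (v t *: X t) i j).
Proof.
by move=> mX i j; under eq_fun do rewrite mxE; exact: measurable_funM.
Qed.

(** The conditional variance of [v] is one, so [v ^+ 2] and the constant [1] are
    the same density against [G]-measurable functions. *)
Lemma increment_isometry n (X : T -> 'cV[R]_n) : L2v P G X ->
  sqint P (fun t => v t *: X t) /\
  ip P (fun t => v t *: X t) (fun t => v t *: X t) = ip P X X.
Proof.
move=> [mX [mX' iX]].
have E : (\int[P]_t (dotv (v t *: X t) (v t *: X t))%:E =
          \int[P]_t (dotv (X t) (X t))%:E)%E.
  transitivity (\int[P]_t (dotv (X t) (X t) * v t ^+ 2)%:E)%E.
    by apply: eq_integral => t _; rewrite dotvZl dotvZr; congr (_%:E); ring.
  transitivity (\int[P]_t (dotv (X t) (X t) * cst 1 t)%:E)%E; last first.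
    by apply: eq_integral => t _; rewrite /= mulr1.
  apply: (integral_density_sub GT) => //.
  - exact: measurable_funX.
  - by move=> t; exact: sqr_ge0.
  - by move=> A GA; have [_ _ _ /(_ A GA)] := v_var.
  - exact: measurable_mx_dotv.
  - by move=> t; exact: dotv_ge0.
split; last by rewrite /ip /Rintegral E.
have mvX := measurable_scalev mX'.
split; first by [].
apply/integrableP; split; first by apply/measurable_EFinP; exact: measurable_dotv.
under eq_integral do rewrite gee0_abs ?lee_fin ?dotv_ge0 //.
by rewrite E -ge0_fin_numE ?integrable_fin_num // integral_ge0 // => t _;
  rewrite lee_fin dotv_ge0.
Qed.

Let pos_neg_density h : measurable_wrt G h -> (forall t, 0 <= h t) ->
  (\int[P]_t (h t * v^\+ t)%:E = \int[P]_t (h t * v^\- t)%:E)%E.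
Proof.
move=> mh h0; apply: (integral_density_sub GT) => //.
- exact: measurable_funrpos.
- exact: measurable_funrneg.
move=> A GA; have [iv _ _ /(_ A GA)] := v_mean.
rewrite integral0_eq //.
have mA := GT GA.
have ivA : P.-integrable A (EFin \o v) by exact: integrableS iv.
have E t : v t = v^\+ t - v^\- t.
  by rewrite -[in LHS](funrposBneg v).
have ip1 : P.-integrable A (EFin \o v^\+).
  apply: (le_integrable mA _ _ ivA).
    by apply/measurable_EFinP; apply: measurable_funTS; exact: measurable_funrpos.
  move=> t _; rewrite /= lee_fin /funrpos ger0_norm ?le_max ?lexx ?orbT //.
  by rewrite ge_max normr_ge0 ler_norm.
have ip2 : P.-integrable A (EFin \o v^\-).
  apply: (le_integrable mA _ _ ivA).
    by apply/measurable_EFinP; apply: measurable_funTS; exact: measurable_funrneg.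
  move=> t _; rewrite /= lee_fin /funrneg ger0_norm ?le_max ?lexx ?orbT //.
  by rewrite ge_max normr_ge0 -normrN ler_norm.
under [X in _ = X -> _]eq_integral do rewrite E EFinB.
rewrite integralB_EFin // => /esym/eqP.
rewrite sube_eq ?add0e; first by move/eqP.
- exact: (integrable_fin_num mA ip1).
- by rewrite fin_num_adde_defl // (integrable_fin_num mA ip2).
Qed.

(** The product of [v] with the [G]-measurable [dotv X Y] is integrable although
    the two factors need not be bounded. Splitting both into positive and
    negative parts reduces the claim to nonnegative integrands, where the
    centring of [v] says that its two parts are the same density over [G]. *)
Lemma increment_orthogonal n (X Y : T -> 'cV[R]_n) : L2v P G X -> L2v P G Y ->
  ip P X (fun t => v t *: Y t) = 0.
Proof.
move=> [mX sX] LY; have [sY _] := increment_isometry LY; have [mY _] := LY.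
have iXY := integrable_dotv sX sY.
pose h t := dotv (X t) (Y t).
have mh : measurable_wrt G h by exact: measurable_mx_dotv.
have mh' := measurable_wrtW GT mh.
have mp : measurable_wrt G h^\+ by exact: measurable_funrpos.
have mn : measurable_wrt G h^\- by exact: measurable_funrneg.
have dec t : dotv (X t) (v t *: Y t) = (h^\+ t * v^\+ t + h^\- t * v^\- t) -
    (h^\+ t * v^\- t + h^\- t * v^\+ t).
  rewrite dotvZr -/(h t).
  have dv : v t = v^\+ t - v^\- t by rewrite -[in LHS](funrposBneg v).
  have dh : h t = h^\+ t - h^\- t by rewrite -[in LHS](funrposBneg h).
  by rewrite [in LHS]dv [in LHS]dh; ring.
have posle (f : T -> R) t : 0 <= f^\+ t <= `|f t|.
  by rewrite /funrpos le_max lexx orbT ge_max normr_ge0 ler_norm.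
have negle (f : T -> R) t : 0 <= f^\- t <= `|f t|.
  by rewrite /funrneg le_max lexx orbT ge_max normr_ge0 -normrN ler_norm.
have dom (f g : T -> R) : measurable_fun setT f -> measurable_fun setT g ->
    (forall t, 0 <= f t <= `|h t|) -> (forall t, 0 <= g t <= `|v t|) ->
    P.-integrable setT (EFin \o (fun t => f t * g t)).
  move=> mf mg fh gv; apply: (le_integrable _ _ _ iXY) => //.
    by apply/measurable_EFinP; exact: measurable_funM.
  move=> t _; have /andP[f0 f1] := fh t; have /andP[g0 g1] := gv t.
  change (`|f t * g t|%:E <= `|dotv (X t) (v t *: Y t)|%:E)%E.
  rewrite lee_fin dotvZr -/(h t) (normrM (v t)) (ger0_norm (mulr_ge0 f0 g0)) mulrC.
  exact: ler_pM.
have i1 := dom _ _ (measurable_wrtW GT mp) (measurable_funrpos mv) (posle h) (posle v).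
have i2 := dom _ _ (measurable_wrtW GT mn) (measurable_funrneg mv) (negle h) (negle v).
have i3 := dom _ _ (measurable_wrtW GT mp) (measurable_funrneg mv) (posle h) (negle v).
have i4 := dom _ _ (measurable_wrtW GT mn) (measurable_funrpos mv) (negle h) (posle v).
rewrite /ip; under eq_Rintegral do rewrite dec.
rewrite RintegralB //; last 2 first.
- exact: (integrableD measurableT i1 i2).
- exact: (integrableD measurableT i3 i4).
rewrite !RintegralD // /Rintegral.
rewrite (pos_neg_density mp) ?(pos_neg_density mn); first by rewrite subrr.
- by move=> t; have /andP[] := negle h t.
- by move=> t; have /andP[] := posle h t.
Qed.

End NormalizedIncrement.

(** * Completeness of the space of square-integrable random vectors *)

Section Completeness.
Context {d : measure_display} {T : measurableType d} {R : realType}.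
Variables (P : probability T R) (G : set (set T)).
Hypothesis GT : <<s G >> `<=` measurable.

Lemma limn_einf_le (u : (\bar R)^nat) c i :
  (forall j, (i <= j)%N -> (u j <= c)%E) -> (limn_einf u <= c)%E.
Proof.
move=> uc; apply: le_trans (limn_einf_sup u) _; rewrite limn_esup_lim.
apply: lime_le; first exact: is_cvg_esups.
exists i => // j ij; apply: ge_ereal_sup => _ [k /= jk <-].
by apply: uc; exact: leq_trans jk.
Qed.

Lemma cvg_of_summable_increments (u : R^nat) :
  (\sum_(0 <= i <oo) `|u i.+1 - u i|%:E < +oo)%E -> cvgn u.
Proof.
move=> uoo.
have nu : cvgn (series (fun i => `|u i.+1 - u i|)).
  apply: nondecreasing_is_cvgn.
    by apply/nondecreasing_seqP => n; rewrite !seriesEnat /= big_nat_recr //= lerDl.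
  exists (fine (\sum_(0 <= i <oo) `|u i.+1 - u i|%:E)%E) => _ [n _ <-].
  rewrite -lee_fin fineK.
    rewrite /series /= -sumEFin; apply: nneseries_lim_ge => i _ _.
    by rewrite lee_fin.
  by rewrite ge0_fin_numE // nneseries_ge0 // => i _ _; rewrite lee_fin.
have := normed_cvg nu.
have -> : series (fun i => u i.+1 - u i) = (fun n => u n - u 0%N).
  by apply/funext => n; rewrite /series /= telescope_sumr.
move=> cu; have -> : u = (fun n => u n - u 0%N) \+ cst (u 0%N).
  by apply/funext => n; rewrite /= subrK.
by apply: is_cvgD => //; exact: is_cvg_cst.
Qed.

(** The rate makes the sum of the increments integrable, hence almost surely
    finite, so the sequence converges almost surely; Fatou's lemma carries the
    rate over to the limit. *)
Lemma sqint_scalar_complete (f : nat -> T -> R) (K : R) :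
  (forall i, measurable_wrt G (f i)) -> 0 <= K ->
  (forall i j, (i <= j)%N ->
    (\int[P]_t ((f i t - f j t) ^+ 2)%:E <= (K / 4 ^+ i)%:E)%E) ->
  exists2 g, measurable_wrt G g &
    forall i, (\int[P]_t ((f i t - g t) ^+ 2)%:E <= (K / 4 ^+ i)%:E)%E.
Proof.
move=> mf K0 fK.
have mf' i := measurable_wrtW GT (mf i).
pose dd i t := `|f i.+1 t - f i t|.
have mdd i : measurable_fun setT (dd i).
  by apply: measurableT_comp => //; exact: measurable_funB.
have msq i j : measurable_fun setT (fun t => (f i t - f j t) ^+ 2).
  by apply: measurable_funX; exact: measurable_funB.
have idd i : (\int[P]_t (dd i t)%:E <= (2 * (K + 1) / (2 ^ i.+1)%:R)%:E)%E.
  pose p : R := 2 ^+ i.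
  have p0 : 0 < p by rewrite exprn_gt0.
  apply: (@le_trans _ _
      (\int[P]_t (p%:E * ((f i t - f i.+1 t) ^+ 2)%:E + (p^-1)%:E))%E).
    (* Young's inequality with weight [p] turns the rate of the squares, a power
       of [1 / 4], into a summable bound on the increments. *)
    apply: ge0_le_integral => //.
    - by move=> t _; rewrite lee_fin normr_ge0.
    - exact/measurable_EFinP.
    - apply/measurable_EFinP; apply: measurable_funD => //.
      exact: measurable_funM.
    - move=> t _; rewrite lee_fin /dd -(normrN (_ - _)) opprB.
      rewrite -(real_normK (num_real (f i t - f i.+1 t))).
      set z := `|_|.
      have : 0 <= p * (z - p^-1) ^+ 2 + z.
        by apply: addr_ge0; [rewrite mulr_ge0 ?sqr_ge0 // ltW|exact: normr_ge0].
      have -> : p * (z - p^-1) ^+ 2 + z = p * z ^+ 2 + p^-1 - z.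
        by field; rewrite gt_eqF.
      by rewrite subr_ge0.
  rewrite ge0_integralD //; last 3 first.
  - by move=> t _; rewrite lee_fin mulr_ge0 ?sqr_ge0 // ltW.
  - by apply/measurable_EFinP; exact: measurable_funM.
  - by move=> t _; rewrite lee_fin invr_ge0 ltW.
  rewrite ge0_integralZl_EFin //; last 3 first.
  - by move=> t _; rewrite lee_fin sqr_ge0.
  - exact/measurable_EFinP.
  - exact: ltW.
  rewrite integral_cst // [X in (_ + _ * X <= _)%E](_ : _ = 1%E); last exact: probability_setT.
  rewrite mule1.
  have -> : 2 * (K + 1) / (2 ^ i.+1)%:R = p * (K / 4 ^+ i) + p^-1.
    rewrite natrX exprS /p (_ : 4 = 2 * 2 :> R); last by rewrite -natrM.
    by rewrite exprMn; field; rewrite expf_neq0.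
  rewrite EFinD EFinM leeD2r // lee_wpmul2l // ?lee_fin ?(ltW p0) //.
  exact: fK.
have sumdd : (\int[P]_t (\sum_(0 <= i <oo) (dd i t)%:E) < +oo)%E.
  rewrite integral_nneseries //; last 2 first.
  - by move=> i; exact/measurable_EFinP.
  - by move=> i t _; rewrite lee_fin normr_ge0.
  apply: (@le_lt_trans _ _ (2 * (K + 1))%:E); last exact: ltry.
  apply: le_trans (epsilon_trick0 predT _); last by rewrite mulr_ge0 ?addr_ge0.
  apply: lee_nneseries => i _; last exact: idd.
  by move=> _; apply: integral_ge0 => t _; rewrite lee_fin normr_ge0.
have dd_ae : \forall t \ae P, (\sum_(0 <= i <oo) (dd i t)%:E < +oo)%E.
  have : P.-integrable setT (fun t => \sum_(0 <= i <oo) (dd i t)%:E)%E.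
    apply/integrableP; split.
      apply: ge0_emeasurable_sum => [i t _ _|i _]; last exact/measurable_EFinP.
      by rewrite lee_fin normr_ge0.
    under eq_integral => t _.
      rewrite gee0_abs; last first.
        by apply: nneseries_ge0 => i _ _; rewrite lee_fin normr_ge0.
      over.
    exact: sumdd.
  move=> /(integrable_ae measurableT); apply: filterS => t /(_ I).
  by rewrite ge0_fin_numE // nneseries_ge0 // => i _ _; rewrite lee_fin normr_ge0.
(* The upper limit is measurable everywhere, including where the sequence
   diverges. *)
pose g t := fine (limn_esup (fun i => (f i t)%:E)).
have mg : measurable_wrt G g.
  apply: measurableT_comp => //.
  apply: measurable_fun_limn_esup => i.
  by apply/measurable_EFinP; exact: mf.
have fg : \forall t \ae P, f i t @[i --> \oo] --> g t.
  apply: filterS dd_ae => t dt.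
  have ct := cvg_of_summable_increments dt.
  have /cvg_limn_einf_sup[_ E] : (f i t)%:E @[i --> \oo] --> (limn (f ^~ t))%:E.
    by apply: cvg_EFin; [exact: nearW|exact: ct].
  by rewrite /g E.
exists g => // i.
apply: (@le_trans _ _
    (\int[P]_t limn_einf (fun j => ((f i t - f j t) ^+ 2)%:E))%E).
  apply: ae_ge0_le_integral => //.
  - by move=> t _; rewrite lee_fin sqr_ge0.
  - apply/measurable_EFinP; apply: measurable_funX; apply: measurable_funB => //.
    exact: measurable_wrtW GT mg.
  - move=> t _; rewrite limn_einf_lim; apply: lime_ge; first exact: is_cvg_einfs.
    apply: nearW => j; apply: le_ereal_inf_tmp => _ [k _ <-].
    by rewrite lee_fin sqr_ge0.
  - rewrite /limn_einf; apply: measurableT_comp => //.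
    apply: measurable_fun_limn_esup => j.
    by apply: measurableT_comp => //; exact/measurable_EFinP.
  apply: filterS fg => t ft _.
  have : ((f i t - f j t) ^+ 2)%:E @[j --> \oo] --> ((f i t - g t) ^+ 2)%:E.
    apply: cvg_EFin; first exact: nearW.
    by rewrite /comp /=; under eq_fun do rewrite expr2; rewrite expr2;
      apply: cvgM; apply: cvgB => //; exact: cvg_cst.
  by move/cvg_limn_einf_sup => [-> _].
apply: le_trans (fatou P measurableT _ _) _.
- by move=> j; exact/measurable_EFinP.
- by move=> j t _; rewrite lee_fin sqr_ge0.
- exact: limn_einf_le (fK i).
Qed.

Lemma L2v_complete n (s : nat -> T -> 'cV[R]_n) (K : R) : 0 <= K ->
  (forall i, L2v P G (s i)) ->
  (forall i j, (i <= j)%N -> ip P (s i - s j) (s i - s j) <= K / 4 ^+ i) ->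
  exists2 X, L2v P G X &
    forall i, ip P (s i - X) (s i - X) <= n%:R * K / 4 ^+ i.
Proof.
move=> K0 Ls sK.
have comp (c : 'I_n) : exists g, measurable_wrt G g /\
    forall i, (\int[P]_t ((s i t c ord0 - g t) ^+ 2)%:E <= (K / 4 ^+ i)%:E)%E.
  have [|//|i j ij|g mg gK] :=
    @sqint_scalar_complete (fun i t => s i t c ord0) K; last by exists g.
    by move=> i; exact: (Ls i).1.
  have [_ [ms is_]] : L2v P G (s i - s j).
    by rewrite addrC -scaleN1r; exact: L2v_lin.
  have E := integrable_fin_num measurableT is_.
  apply: (@le_trans _ _ (\int[P]_t (dotv ((s i - s j) t) ((s i - s j) t))%:E)%E).
    apply: ge0_le_integral => //.
    - by move=> t _; rewrite lee_fin sqr_ge0.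
    - apply/measurable_EFinP; apply: measurable_funX; apply: measurable_funB.
        by have [_ []] := Ls i.
      by have [_ []] := Ls j.
    - by apply/measurable_EFinP; exact: measurable_dotv.
    - move=> t _; rewrite lee_fin dotvE (bigD1 c) //= !fctE !mxE expr2 lerDl.
      by rewrite sumr_ge0 // => k _; rewrite -expr2 sqr_ge0.
  by rewrite -(fineK E) lee_fin; exact: sK.
have [g gP] := choice comp.
pose X t : 'cV[R]_n := \col_c g c t.
have mX : measurable_mx G X.
  move=> i j; rewrite /measurable_wrt; under eq_fun do rewrite mxE.
  exact: (gP i).1.
have mX' i j : measurable_fun setT (fun t => X t i j).
  exact: (measurable_wrtW GT (mX i j)).
have ms' i c k : measurable_fun setT (fun t => s i t c k) by have [_ []] := Ls i.
have bnd i : (\int[P]_t (dotv ((s i - X) t) ((s i - X) t))%:E <=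
    (n%:R * K / 4 ^+ i)%:E)%E.
  under eq_integral => t _.
    rewrite dotvE (_ : \sum_c _ = \sum_c (s i t c ord0 - g c t) ^+ 2); last first.
      by apply: eq_bigr => c _; rewrite !fctE !mxE expr2.
    rewrite -sumEFin; over.
  rewrite ge0_integral_sum //; last 2 first.
  - move=> c; apply/measurable_EFinP; apply: measurable_funX.
    by apply: measurable_funB => //; exact: measurable_wrtW GT (gP c).1.
  - by move=> c t _; rewrite lee_fin sqr_ge0.
  apply: (@le_trans _ _ (\sum_(c < n) (K / 4 ^+ i)%:E)%E).
    by apply: lee_sum => c _; exact: (gP c).2.
  rewrite sumEFin lee_fin (_ : n%:R * K / 4 ^+ i = \sum_(c < n) K / 4 ^+ i) //.
  by rewrite sumr_const card_ord -[RHS]mulr_natl mulrA.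
have sd i : sqint P (s i - X).
  have m j k : measurable_fun setT (fun t => (s i - X) t j k).
    rewrite (_ : (fun t => _) = (fun t => s i t j k - X t j k)).
      exact: measurable_funB.
    by apply/funext => t; rewrite !fctE !mxE.
  split=> //; apply/integrableP; split.
    by apply/measurable_EFinP; exact: measurable_dotv.
  under eq_integral do rewrite gee0_abs ?lee_fin ?dotv_ge0 //.
  by apply: le_lt_trans (bnd i) _; exact: ltry.
exists X.
  split=> //.
  have -> : X = -1 *: (s 0%N - X) + s 0%N by rewrite scaleN1r opprB addrNK.
  by apply: sqint_lin => //; have [] := Ls 0%N.
move=> i; rewrite -lee_fin /ip /Rintegral fineK ?bnd //.
by apply: (integrable_fin_num measurableT); have [] := sd i.
Qed.

End Completeness.

(** * Conditional expectation as an orthogonal projection *)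

Section ConditionalExpectation.
Context {d : measure_display} {T : measurableType d} {R : realType}.
Variables (P : probability T R) (G : set (set T)).
Hypothesis GT : <<s G >> `<=` measurable.

(** The difference of two versions is [G]-measurable, so the set where it is
    positive is admissible in the defining identity. *)
Lemma is_condexp_ae_unique f g1 g2 :
  is_condexp P G f g1 -> is_condexp P G f g2 -> ae_same P g1 g2.
Proof.
move=> [_ i1 m1 e1] [_ i2 m2 e2].
pose D t := g1 t - g2 t.
have mD : measurable_wrt G D by exact: measurable_funB.
have mD' := measurable_wrtW GT mD.
have iD A : measurable A -> P.-integrable A (EFin \o D).
  move=> mA; apply: (@integrableS _ _ _ _ setT) => //.
  by have := integrableB measurableT i1 i2; apply: eq_integrable.
have D0 A : <<s G >> A -> (\int[P]_(t in A) (D t)%:E = 0)%E.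
  move=> GA; have mA := GT GA.
  have j1 : P.-integrable A (EFin \o g1) by exact: integrableS i1.
  have j2 : P.-integrable A (EFin \o g2) by exact: integrableS i2.
  under eq_integral do rewrite EFinB.
  rewrite integralB_EFin // e1 // e2 // subee //.
  by rewrite -e2 //; exact: (integrable_fin_num mA j2).
pose A := [set t | 0 < D t].
have GA : <<s G >> A.
  have := mD measurableT _ (measurable_itv `]0, +oo[).
  rewrite setTI (_ : _ @^-1` _ = A) //.
  by apply/seteqP; split => t; rewrite /A /= in_itv /= andbT.
have GnA : <<s G >> (~` A).
  by have := @sigma_algebraCD _ setT G A GA; rewrite setTD.
have absD : (\int[P]_t `|(D t)%:E| = 0)%E.
  rewrite -(setUv A) ge0_integral_setU //=; last 4 first.
  - exact: GT.
  - exact: GT.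
  - rewrite setUv; apply/measurable_EFinP; exact: measurableT_comp.
  - by apply/disj_setPCl.
  rewrite (_ : \int[P]_(t in A) _ = \int[P]_(t in A) (D t)%:E)%E; last first.
    by apply: eq_integral => t; rewrite inE /A /= => Dt; rewrite gtr0_norm.
  rewrite (_ : \int[P]_(t in ~` A) _ = \int[P]_(t in ~` A) - (D t)%:E)%E; last first.
    apply: eq_integral => t; rewrite inE /A /= => /negP; rewrite -leNgt => Dt.
    by rewrite ler0_norm.
  rewrite integralN /=; last first.
    by apply: integrable_add_def; [exact: GT|apply: iD; exact: GT].
  by rewrite !D0 // oppe0 adde0.
have mDE : measurable_fun setT (EFin \o D) by exact/measurable_EFinP.
move/(ae_eq_integral_abs P measurableT mDE).1: absD.
by apply: filterS => t /(_ I) [] /eqP; rewrite subr_eq0 => /eqP.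
Qed.

Lemma condexp_spec f g : is_condexp P G f g ->
  is_condexp P G f (condexp P G f) /\ ae_same P (condexp P G f) g.
Proof.
move=> fg; have fc : is_condexp P G f (condexp P G f).
  by rewrite /condexp; case: xgetP => [h _ //|/(_ g)].
by split=> //; exact: is_condexp_ae_unique fc fg.
Qed.

(** The conditional expectation is produced as the element of the
    square-integrable [G]-measurable vectors that represents the functional
    [h |-> E <F, h>]. The hypotheses are those met by the product of two
    square-integrable variables, which is merely integrable. *)
Lemma condexp_mx_spec n (F : T -> 'cV[R]_n) K :
  (forall i, P.-integrable setT (fun t => (F t i ord0)%:E)) ->
  (forall h, L2v P G h -> P.-integrable setT (fun t => (dotv (F t) (h t))%:E)) ->
  (forall h, L2v P G h -> ip P F h ^+ 2 <= K * ip P h h) ->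
  L2v P G (condexp_mx P G F) /\
  forall h, L2v P G h -> ip P (condexp_mx P G F) h = ip P F h.
Proof.
move=> iF iFh Fbnd.
have [Z LZ ZF] : exists2 Z, L2v P G Z & forall h, L2v P G h -> ip P Z h = ip P F h.
  apply: (@riesz_representation R _ (@L2v _ _ _ P G n) (@ip _ _ _ P n)
            (fun h => ip P F h) K) => //.
  - exact: L2v0.
  - by move=> c u v; exact: L2v_lin.
  - by move=> u v _ _; exact: ipC.
  - by move=> c u v h [_ su] [_ sv] [_ sh]; exact: ip_linl.
  - by move=> u _; exact: ip_ge0.
  - move=> s Ls sK; have [X LX XK] := L2v_complete GT ler01 Ls sK.
    by exists X => //; exists (n%:R * 1).
  - move=> c u v Lu Lv; have iu := iFh _ Lu; have iv := iFh _ Lv.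
    rewrite /ip; under eq_Rintegral => t _.
      rewrite (_ : (c *: u + v) t = c *: u t + v t) // dotvDr dotvZr; over.
    rewrite RintegralD //=; first by rewrite RintegralZl.
    have := integrableZl measurableT c iu.
    by apply: eq_integrable => // t _; rewrite -EFinM.
have [mZ [mZ' iZZ]] := LZ.
have Zcond i : is_condexp P G (fun t => F t i ord0) (fun t => Z t i ord0).
  pose h (A : set T) t : 'cV[R]_n := \1_A t *: delta_mx i ord0.
  have dh Y A t : dotv Y (h A t) = \1_A t * Y i ord0.
    by rewrite dotvZr dotv_delta.
  have Lh A : <<s G >> A -> L2v P G (h A).
    move=> GA; have mA := GT GA.
    have mh : measurable_mx G (h A).
      move=> j k; rewrite /measurable_wrt.
      rewrite (_ : (fun t => _) = (fun t => \1_A t * (delta_mx i ord0 : 'cV[R]_n) j k)).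
        apply: measurable_funM; last exact: measurable_cst.
        exact: (@measurable_indic _ (g_sigma_algebraType G) _ setT A).
      by apply/funext => t; rewrite mxE.
    split=> //; split; first by move=> j k; exact: (measurable_wrtW GT (mh j k)).
    have : P.-integrable setT (EFin \o \1_A : T -> \bar R).
      exact: integrable_indic.
    apply: eq_integrable => // t _; rewrite dh /= /h !mxE eqxx mulr1.
    by rewrite indicE; case: (t \in A); rewrite /= ?mulr1 ?mulr0.
  have iZ : P.-integrable setT (fun t => (Z t i ord0)%:E).
    have LhT : L2v P G (h setT) by apply: Lh; exact: (@measurableT _ (g_sigma_algebraType G)).
    have := integrable_dotv LZ.2 LhT.2.
    by apply: eq_integrable => // t _; rewrite dh indicE in_setT mul1r.
  split; [exact: iF|exact: iZ|exact: mZ|].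
  move=> A GA; have mA := GT GA.
  have LhA := Lh _ GA.
  have int (Y : T -> 'cV[R]_n) : P.-integrable setT (fun t => (Y t i ord0)%:E) ->
      (\int[P]_(t in A) (Y t i ord0)%:E = (ip P Y (h A))%:E)%E.
    move=> iY; rewrite /ip /Rintegral fineK; last first.
      have iYA : P.-integrable A (fun t => (Y t i ord0)%:E) by exact: integrableS iY.
      have := integrable_fin_num mA iYA; rewrite integral_mkcond.
      rewrite (_ : \int[P]_x _ = \int[P]_x (dotv (Y x) (h A x))%:E)%E //.
      apply: eq_integral => t _; rewrite dh patchE indicE.
      by case: ifP; rewrite ?mul1r ?mul0r.
    rewrite [LHS]integral_mkcond; apply: eq_integral => t _; rewrite dh patchE indicE.
    by case: ifP; rewrite ?mul1r ?mul0r.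
  by rewrite int // int // ZF.
have spec i := condexp_spec (Zcond i).
have CZ : ae_same P (condexp_mx P G F) Z.
  have : \forall t \ae P, forall i : 'I_n,
      condexp P G (fun s => F s i ord0) t = Z t i ord0.
    by apply: filter_forall => i; exact: (spec i).2.
  by apply: filterS => t E; apply/colP => i; rewrite mxE.
have mC : measurable_mx G (condexp_mx P G F).
  move=> i j; rewrite /measurable_wrt; under eq_fun do rewrite mxE ord1.
  by have [[_ _ mc _] _] := spec i.
have LC : L2v P G (condexp_mx P G F).
  split=> //; apply: (sqint_ae LZ.2); last exact: ae_same_sym CZ.
  by move=> i j; exact: (measurable_wrtW GT (mC i j)).
split=> // h Lh; rewrite -ZF //; apply: ip_ae CZ; [exact: LC.2|exact: LZ.2|exact: Lh.2].
Qed.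

End ConditionalExpectation.

(** * The filtration and the discounted space of processes *)

Section Filtration.
Context {d : measure_display} {T : measurableType d} {R : realType}.
Variable w : nat -> T -> R.

Lemma past_minimal k (M : set (set T)) : sigma_algebra setT M ->
  (forall i (B : set R), (i < k)%N -> measurable B -> M (w i @^-1` B)) ->
  <<s past w k >> `<=` M.
Proof.
move=> sM wM; apply: smallest_sub => //; apply: smallest_sub => //.
apply: (big_ind (fun S => S `<=` M)) => //.
- by move=> A B AM BM C [/AM|/BM].
- move=> i _ _ [B mB <-]; rewrite setTI; exact: wM.
Qed.

Lemma past_preimage k i (B : set R) : (i < k)%N -> measurable B ->
  <<s past w k >> (w i @^-1` B).
Proof.
move=> ik mB; apply: sub_sigma_algebra; apply: sub_sigma_algebra.
rewrite (bigD1 (Ordinal ik)) //=; left; exists B => //.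
by rewrite setTI.
Qed.

Lemma past_mono j k : (j <= k)%N -> <<s past w j >> `<=` <<s past w k >>.
Proof.
move=> jk; apply: past_minimal; first exact: smallest_sigma_algebra.
by move=> i B ij mB; apply: past_preimage mB; exact: leq_trans jk.
Qed.

Lemma past_measurable k : (forall i, measurable_fun setT (w i)) ->
  <<s past w k >> `<=` measurable.
Proof.
move=> mw; apply: past_minimal; first exact: sigma_algebra_measurable.
by move=> i B _ mB; rewrite -[_ @^-1` _]setTI; exact: mw.
Qed.

Lemma past_adapted k : measurable_wrt (past w k.+1) (w k).
Proof.
move=> _ B mB; rewrite setTI.
exact: past_preimage mB.
Qed.

End Filtration.

Section Processes.
Context {d : measure_display} {T : measurableType d} {R : realType}.
Variables (P : probability T R) (w : nat -> T -> R) (rho : R).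
Hypothesis mw : forall k, measurable_fun setT (w k).
Implicit Types n m : nat.

Let pastT k : <<s past w k >> `<=` measurable := past_measurable mw.

(** [L2rho] in terms of real numbers: each coordinate is square integrable and
    the discounted partial sums are bounded; see [L2rhoP]. *)
Definition L2p n (g : nat -> T -> 'cV[R]_n) : Prop :=
  (forall k, L2v P (past w k) (g k)) /\
  exists K, forall N, \sum_(0 <= k < N) discount rho k * ip P (g k) (g k) <= K.

Definition IP n (g h : nat -> T -> 'cV[R]_n) : R :=
  limn (series (fun k => discount rho k * ip P (g k) (h k))).

Lemma discount_gt0 k : 0 < discount rho k.
Proof. exact: expR_gt0. Qed.
Local Hint Extern 0 (is_true (0 < discount _ _)) => exact: discount_gt0 : core.

Lemma discount_ge0 k : 0 <= discount rho k.
Proof. exact: ltW. Qed.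
Local Hint Extern 0 (is_true (0 <= discount _ _)) => exact: discount_ge0 : core.

Lemma discount0 : discount rho 0 = 1.
Proof. by rewrite /discount mulr0 oppr0 expR0. Qed.

Lemma discountS k : discount rho k.+1 = expR (- rho) * discount rho k.
Proof. by rewrite /discount -expRD -natr1; congr expR; ring. Qed.

Lemma L2p_sqint n (g : nat -> T -> 'cV[R]_n) k : L2p g -> sqint P (g k).
Proof. by move=> [/(_ k)[]]. Qed.

Lemma cvg_bounded_series (u : R^nat) K : (forall k, 0 <= u k) ->
  (forall N, \sum_(0 <= k < N) u k <= K) -> cvgn (series u).
Proof.
move=> u0 uK; apply: nondecreasing_is_cvgn.
  by apply/nondecreasing_seqP => k; rewrite !seriesEnat /= big_nat_recr //= lerDl.
by exists K => _ [N _ <-]; rewrite seriesEnat; exact: uK.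
Qed.

Lemma L2p_cvg_norm n (g : nat -> T -> 'cV[R]_n) : L2p g ->
  cvgn (series (fun k => discount rho k * ip P (g k) (g k))).
Proof.
move=> [_ [K gK]]; apply: cvg_bounded_series gK => k.
by rewrite mulr_ge0 // ip_ge0.
Qed.

Lemma ip_young n (X Y : T -> 'cV[R]_n) : sqint P X -> sqint P Y ->
  `|ip P X Y| <= ip P X X + ip P Y Y.
Proof.
move=> sX sY; have := ip_cauchy_schwarz sX sY.
have := ip_ge0 P X; have := ip_ge0 P Y.
set a := ip P X X; set b := ip P Y Y; set c := ip P X Y => b0 a0 h.
rewrite -(@ler_pXn2r _ 2) ?nnegrE ?addr_ge0 // real_normK ?num_real //.
nra.
Qed.

Lemma L2p_cvg n (g h : nat -> T -> 'cV[R]_n) : L2p g -> L2p h ->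
  cvgn (series (fun k => discount rho k * ip P (g k) (h k))).
Proof.
move=> Lg Lh.
suff /normed_cvg : cvgn (series (fun k => `|discount rho k * ip P (g k) (h k)|)).
  exact.
apply: (@series_le_cvg _ _ (fun k => discount rho k * ip P (g k) (g k) +
    discount rho k * ip P (h k) (h k))).
- by move=> k; exact: normr_ge0.
- by move=> k; rewrite addr_ge0 // mulr_ge0 // ip_ge0.
- move=> k; rewrite normrM ger0_norm // -mulrDr ler_wpM2l //.
  by apply: ip_young; exact: L2p_sqint.
- exact: (is_cvg_seriesD (L2p_cvg_norm Lg) (L2p_cvg_norm Lh)).
Qed.

Lemma IPC n (g h : nat -> T -> 'cV[R]_n) : IP g h = IP h g.
Proof. by rewrite /IP; under eq_fun do rewrite ipC. Qed.

Lemma L2p_partial_le n (g : nat -> T -> 'cV[R]_n) N : L2p g ->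
  \sum_(0 <= k < N) discount rho k * ip P (g k) (g k) <= IP g g.
Proof.
move=> Lg; rewrite -[leLHS]/(series _ N).
apply: nondecreasing_cvgn_le; last exact: L2p_cvg_norm.
apply/nondecreasing_seqP => k; rewrite !seriesEnat /= big_nat_recr //= lerDl.
by rewrite mulr_ge0 // ip_ge0.
Qed.

Lemma IP_ge0 n (g : nat -> T -> 'cV[R]_n) : L2p g -> 0 <= IP g g.
Proof. by move=> Lg; have := L2p_partial_le 0 Lg; rewrite big_nil. Qed.

Lemma IP_le_ub n (g : nat -> T -> 'cV[R]_n) K : L2p g ->
  (forall N, \sum_(0 <= k < N) discount rho k * ip P (g k) (g k) <= K) ->
  IP g g <= K.
Proof.
move=> Lg gK; apply: limr_le; first exact: L2p_cvg_norm.
by apply: nearW => N; rewrite seriesEnat; exact: gK.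
Qed.

Lemma L2p_lin n (g h : nat -> T -> 'cV[R]_n) c : L2p g -> L2p h ->
  L2p (c *: g + h).
Proof.
move=> Lg Lh; split.
  by move=> k; rewrite !fctE; apply: L2v_lin; [exact: Lg.1|exact: Lh.1].
exists (2 * c ^+ 2 * IP g g + 2 * IP h h) => N.
apply: (@le_trans _ _ (\sum_(0 <= k < N)
   (2 * c ^+ 2 * (discount rho k * ip P (g k) (g k)) +
    2 * (discount rho k * ip P (h k) (h k))))).
  apply: ler_sum => k _.
  have sg := L2p_sqint k Lg; have sh := L2p_sqint k Lh.
  have sgh := sqint_lin c sg sh; have sgh' := sqint_lin (- c) sg sh.
  have -> : (c *: g + h) k = c *: g k + h k by [].
  have := ip_ge0 P (- c *: g k + h k).
  rewrite !ip_linl // !(ipC _ _ (_ *: _ + _)) !ip_linl // (ipC _ (h k) (g k)).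
  set a := ip P (g k) (g k); set b := ip P (h k) (h k); set e := ip P (g k) (h k).
  move=> h0.
  have h1 : c * (c * a + e) + (c * e + b) <= 2 * c ^+ 2 * a + 2 * b by nra.
  apply: le_trans (ler_wpM2l (discount_ge0 k) h1) _.
  by rewrite le_eqVlt; apply/orP; left; apply/eqP; ring.
rewrite big_split /= -!mulr_sumr.
have c0 := sqr_ge0 c.
by apply: lerD; apply: ler_wpM2l; rewrite ?L2p_partial_le ?(mulr_ge0 _ c0).
Qed.

Lemma L2p0 n : L2p (0 : nat -> T -> 'cV[R]_n).
Proof.
split; first by move=> k; exact: L2v0.
exists 0 => N; rewrite big1 // => k _.
by rewrite (_ : (0 : nat -> T -> 'cV[R]_n) k = 0) // ip0l mulr0.
Qed.

Lemma limn_lin (u v : R^nat) c : cvgn u -> cvgn v ->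
  limn (fun N => c * u N + v N) = c * limn u + limn v.
Proof.
move=> cu cv; apply/cvg_lim => //; apply: cvgD cv.
by apply: cvgM cu; exact: cvg_cst.
Qed.

Lemma IP_linl n (g h q : nat -> T -> 'cV[R]_n) c : L2p g -> L2p h -> L2p q ->
  IP (c *: g + h) q = c * IP g q + IP h q.
Proof.
move=> Lg Lh Lq; have cg := L2p_cvg Lg Lq; have ch := L2p_cvg Lh Lq.
rewrite /IP -(limn_lin c cg ch); congr (limn _); apply/funext => N.
rewrite !seriesEnat /= mulr_sumr -big_split /=; apply: eq_bigr => k _.
by rewrite (ip_linl c (L2p_sqint k Lg) (L2p_sqint k Lh) (L2p_sqint k Lq)); ring.
Qed.

Lemma IP_cauchy_schwarz n (g h : nat -> T -> 'cV[R]_n) : L2p g -> L2p h ->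
  IP g h ^+ 2 <= IP g g * IP h h.
Proof.
move=> Lg Lh.
apply: (@form_cauchy_schwarz R _ (@L2p n) (@IP n) _ _ _ _ g h Lg Lh).
- by move=> c u v; exact: L2p_lin.
- by move=> u v _ _; exact: IPC.
- by move=> c u v q; exact: IP_linl.
- by move=> u; exact: IP_ge0.
Qed.

Lemma IP_eq0 n (g : nat -> T -> 'cV[R]_n) : L2p g -> IP g g <= 0 ->
  forall k, ae_same P (g k) (fun=> 0).
Proof.
move=> Lg g0 k; apply: ip_eq0; first exact: L2p_sqint.
have := le_trans (L2p_partial_le k.+1 Lg) g0.
rewrite big_nat_recr //= => h.
have s0 : 0 <= \sum_(0 <= i < k) discount rho i * ip P (g i) (g i).
  by rewrite sumr_ge0 // => i _; rewrite mulr_ge0 // ip_ge0.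
have : discount rho k * ip P (g k) (g k) <= 0 by lra.
rewrite pmulr_rle0 // => h1; apply/eqP; rewrite eq_le h1; exact: ip_ge0.
Qed.

Lemma IP_ae n (g g' h : nat -> T -> 'cV[R]_n) : L2p g -> L2p g' -> L2p h ->
  (forall k, ae_same P (g k) (g' k)) -> IP g h = IP g' h.
Proof.
move=> Lg Lg' Lh gg'; rewrite /IP; congr (limn (series _)).
by apply/funext => k; rewrite (ip_ae _ _ _ (gg' k)) //; exact: L2p_sqint.
Qed.

Lemma L2p_dom n m (g : nat -> T -> 'cV[R]_n) (h : nat -> T -> 'cV[R]_m) c :
  L2p g -> 0 <= c -> (forall k, L2v P (past w k) (h k)) ->
  (forall k, ip P (h k) (h k) <= c * ip P (g k) (g k)) ->
  L2p h /\ IP h h <= c * IP g g.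
Proof.
move=> Lg c0 Lh hg.
have bnd N : \sum_(0 <= k < N) discount rho k * ip P (h k) (h k) <= c * IP g g.
  apply: (@le_trans _ _
     (c * \sum_(0 <= k < N) discount rho k * ip P (g k) (g k))).
    by rewrite mulr_sumr; apply: ler_sum => k _; rewrite mulrCA ler_wpM2l.
  by rewrite ler_wpM2l // L2p_partial_le.
have Lp : L2p h by split=> //; exists (c * IP g g).
by split=> //; exact: IP_le_ub.
Qed.

Lemma IP_linr n (g h q : nat -> T -> 'cV[R]_n) c : L2p g -> L2p h -> L2p q ->
  IP q (c *: g + h) = c * IP q g + IP q h.
Proof.
move=> Lg Lh Lq; rewrite (IPC q g) (IPC q h) -(IP_linl c Lg Lh Lq).
exact: IPC.
Qed.

Lemma L2pB n (g h : nat -> T -> 'cV[R]_n) : L2p g -> L2p h -> L2p (g - h).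
Proof. by move=> Lg Lh; rewrite addrC -scaleN1r; apply: L2p_lin. Qed.

Lemma IPBl n (g h q : nat -> T -> 'cV[R]_n) : L2p g -> L2p h -> L2p q ->
  IP (g - h) q = IP g q - IP h q.
Proof.
move=> Lg Lh Lq; have := IP_linl (-1) Lh Lg Lq.
by rewrite scaleN1r addrC mulN1r (addrC (- _)).
Qed.

(** Completeness of each coordinate space gives the limit of every [s i k];
    the rate for the whole process follows by comparing finitely many
    coordinates with a far term of the sequence. *)
Lemma L2p_complete n (s : nat -> nat -> T -> 'cV[R]_n) K : 0 <= K ->
  (forall i, L2p (s i)) ->
  (forall i j, (i <= j)%N -> IP (s i - s j) (s i - s j) <= K / 4 ^+ i) ->
  exists2 g, L2p g & forall i, IP (s i - g) (s i - g) <= 2 * K / 4 ^+ i.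
Proof.
move=> K0 Ls sK.
have coord k : exists X, L2v P (past w k) X /\ forall i,
    ip P (s i k - X) (s i k - X) <= n%:R * (K / discount rho k) / 4 ^+ i.
  have [||i j ij|X LX XP] :=
      @L2v_complete _ _ _ P _ (@pastT k) n (fun i => s i k) (K / discount rho k).
  - by rewrite divr_ge0.
  - by move=> i; exact: (Ls i).1.
  - have := le_trans (L2p_partial_le k.+1 (L2pB (Ls i) (Ls j))) (sK _ _ ij).
    rewrite big_nat_recr //= => h.
    rewrite mulrAC ler_pdivlMr // mulrC; apply: le_trans h.
    by rewrite lerDr sumr_ge0 // => l _; rewrite mulr_ge0 // ip_ge0.
  - by exists X.
have [g gP] := choice coord.
have Lg k : L2v P (past w k) (g k) by have [] := gP k.
have bnd i N : \sum_(0 <= k < N) discount rho k *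
    ip P ((s i - g) k) ((s i - g) k) <= 2 * K / 4 ^+ i.
  have step j : (i <= j)%N -> \sum_(0 <= k < N) discount rho k *
      ip P ((s i - g) k) ((s i - g) k) <=
      2 * K / 4 ^+ i + 2 * N%:R * n%:R * K / 4 ^+ j.
    move=> ij.
    apply: (@le_trans _ _ (2 * (\sum_(0 <= k < N) discount rho k *
      ip P ((s i - s j) k) ((s i - s j) k)) +
      \sum_(0 <= k < N) 2 * (n%:R * K / 4 ^+ j))); last first.
      apply: lerD.
        rewrite -mulrA ler_wpM2l //; apply: le_trans (sK _ _ ij).
        exact: L2p_partial_le (L2pB (Ls i) (Ls j)).
      rewrite sumr_const_nat subn0 -[leLHS]mulr_natl.
      by rewrite le_eqVlt; apply/orP; left; apply/eqP; ring.
    rewrite mulr_sumr -big_split /=; apply: ler_sum => k _.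
    have [_ /(_ j) gj] := gP k.
    pose X := s i k - s j k; pose Y := s j k - g k.
    have sX : sqint P X := L2p_sqint k (L2pB (Ls i) (Ls j)).
    have sY : sqint P Y.
      rewrite /Y addrC -scaleN1r; apply: sqint_lin; first exact: (Lg k).2.
      exact: L2p_sqint.
    have -> : (s i - g) k = 1 *: X + Y.
      by rewrite scale1r /X /Y addrA addrNK.
    rewrite -[(s i - s j) k]/X.
    have := ip_ge0 P (- 1 *: X + Y).
    rewrite !ip_linl // ?(ipC _ _ (_ *: _ + _)) ?ip_linl // ?(ipC _ Y X);
      try exact: sqint_lin.
    move: gj; rewrite -/Y.
    set a := ip P X X; set b := ip P Y Y; set e := ip P X Y => gj h0.
    have {}gj : discount rho k * b <= n%:R * K / 4 ^+ j.
      apply: le_trans (ler_wpM2l (discount_ge0 k) gj) _.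
      by rewrite le_eqVlt; apply/orP; left; apply/eqP; field;
         rewrite expf_neq0 // gt_eqF.
    have h1 : 1 * (1 * a + e) + (1 * e + b) <= 2 * a + 2 * b by lra.
    apply: le_trans (ler_wpM2l (discount_ge0 k) h1) _.
    by rewrite mulrDr mulrCA lerD2l mulrCA ler_wpM2l.
  set c := 2 * K / 4 ^+ i; set D := 2 * N%:R * n%:R * K in step.
  have cv : (c + D / 4 ^+ j) @[j --> \oo] --> c.
    rewrite -[X in _ --> X]addr0; apply: cvgD; first exact: cvg_cst.
    have := @cvg_geometric R D 4^-1; rewrite ger0_norm // invf_lt1 // ltr1n.
    move=> /(_ isT); apply: cvg_trans; apply: near_eq_cvg; apply: nearW => l.
    by rewrite /= exprVn.
  rewrite -(cvg_lim _ cv) //; apply: limr_ge; first by apply/cvg_ex; exists c.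
  by exists i => // j /= ij; exact: step.
have Ld i : L2p (s i - g).
  split; last by exists (2 * K / 4 ^+ i); exact: bnd.
  move=> k; rewrite (_ : (s i - g) k = -1 *: g k + s i k).
    by apply: L2v_lin => //; exact: (Ls i).1.
  by rewrite scaleN1r addrC.
exists g; last by move=> i; apply: IP_le_ub; [exact: Ld|exact: bnd].
have -> : g = -1 *: (s 0%N - g) + s 0%N by rewrite scaleN1r opprB addrNK.
exact: L2p_lin.
Qed.

Lemma L2rhoP n (g : nat -> T -> 'cV[R]_n) : L2rho P w rho g <-> L2p g.
Proof.
have nng k t : (0 <= (discount rho k * dotv (g k t) (g k t))%:E)%E.
  by rewrite lee_fin mulr_ge0 // dotv_ge0.
have E (mg : forall k i j, measurable_fun setT (fun t => g k t i j)) :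
  (\int[P]_t (\sum_(0 <= k <oo) (discount rho k * mxnorm (g k t) ^+ 2)%:E) =
   \sum_(0 <= k <oo) (discount rho k)%:E *
      \int[P]_t (dotv (g k t) (g k t))%:E)%E.
  transitivity (\int[P]_t (\sum_(0 <= k <oo)
      (discount rho k * dotv (g k t) (g k t))%:E))%E.
    by apply: eq_integral => t _; apply: eq_eseriesr => k _; rewrite mxnorm_sqr_cV.
  rewrite integral_nneseries //; last first.
    move=> k; apply/measurable_EFinP; apply: measurable_funM => //.
    exact: measurable_dotv.
  apply: eq_eseriesr => k _; under eq_integral do rewrite EFinM.
  rewrite ge0_integralZl_EFin //.
  - by move=> t _; rewrite lee_fin dotv_ge0.
  - by apply/measurable_EFinP; exact: measurable_dotv.
split=> [[pg]|Lg].
  have mg k i j : measurable_fun setT (fun t => g k t i j).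
    exact: (measurable_wrtW (@pastT k) (pg k i j)).
  rewrite E // => goo.
  have i0 k : (0 <= \int[P]_t (dotv (g k t) (g k t))%:E)%E.
    by apply: integral_ge0 => t _; rewrite lee_fin dotv_ge0.
  have s0 k : (0 <= (discount rho k)%:E * \int[P]_t (dotv (g k t) (g k t))%:E)%E.
    by apply: mule_ge0; [rewrite lee_fin discount_ge0|exact: i0].
  have ik k : (\int[P]_t (dotv (g k t) (g k t))%:E < +oo)%E.
    rewrite ltey; apply/negP => /eqP ioo.
    have := le_lt_trans (nneseries_lim_ge k.+1 (fun l _ _ => s0 l)) goo.
    rewrite big_nat_recr //= ioo gt0_muley ?lte_fin // addey //.
    rewrite -ltNye; apply: lt_le_trans (sume_ge0 _ _); rewrite ?ltNy0 //.
  have sg k : sqint P (g k).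
    split=> //; apply/integrableP; split.
      by apply/measurable_EFinP; exact: measurable_dotv.
    by under eq_integral do rewrite gee0_abs ?lee_fin ?dotv_ge0 //.
  split=> //.
  exists (fine (\sum_(0 <= k <oo) (discount rho k)%:E *
      \int[P]_t (dotv (g k t) (g k t))%:E)%E) => N.
  rewrite -lee_fin fineK; last by rewrite ge0_fin_numE // nneseries_ge0.
  rewrite -sumEFin; apply: le_trans (nneseries_lim_ge N (fun l _ _ => s0 l)).
  apply: lee_sum => k _; rewrite EFinM /ip /Rintegral fineK // ge0_fin_numE //.
have mg k : measurable_mx (past w k) (g k) by have [/(_ k)[]] := Lg.
split=> //; rewrite E; last by move=> k; have [_ []] := Lg.1 k.
apply: (@le_lt_trans _ _ (IP g g)%:E); last exact: ltry.
apply: lime_le.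
  apply: is_cvg_nneseries => k _ _; apply: mule_ge0; first by rewrite lee_fin discount_ge0.
  by apply: integral_ge0 => t _; rewrite lee_fin dotv_ge0.
apply: nearW => N; apply: le_trans (_ : (_ <= (\sum_(0 <= k < N)
  discount rho k * ip P (g k) (g k))%:E)%E) _; last first.
  by rewrite lee_fin; exact: L2p_partial_le.
rewrite -sumEFin; apply: lee_sum => k _; rewrite EFinM /ip /Rintegral fineK //.
by apply: (integrable_fin_num measurableT); have [_ []] := Lg.1 k.
Qed.

End Processes.

(** * Linear dynamics and the adjoint equation *)

Section LinearDynamics.
Context {d : measure_display} {T : measurableType d} {R : realType}.
Variables (P : probability T R) (w : nat -> T -> R) (rho : R).
Hypothesis w_mds : normalized_martingale_difference P w.
Implicit Types n m p : nat.

Let mw : forall k, measurable_fun setT (w k).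
Proof. by case: w_mds. Qed.

Let pastT k : <<s past w k >> `<=` measurable := past_measurable mw.

Definition bounded_mx n m (A : nat -> T -> 'M[R]_(n, m)) (a : R) : Prop :=
  [/\ 0 <= a, predictable w A & forall k, \forall t \ae P, mxnorm (A k t) <= a].

Lemma Linf_bounded n m (A : nat -> T -> 'M[R]_(n, m)) : Linf P w A ->
  bounded_mx A (fine (Linf_norm P A)) /\ ((fine (Linf_norm P A))%:E = Linf_norm P A)%E.
Proof.
move=> [pA Aoo].
have A0 : (0 <= Linf_norm P A)%E.
  apply: le_trans (ereal_sup_ubound _); last by exists 0%N.
  apply: ess_sup_gee.
    by rewrite [X in (_ < X)%E](_ : _ = 1%E) ?lte01 //; exact: probability_setT.
  by apply: nearW => t; rewrite lee_fin mxnorm_ge0.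
have fA : Linf_norm P A \is a fin_num by rewrite ge0_fin_numE.
split; last exact: fineK.
split=> //; first exact: fine_ge0.
move=> k; have := ess_sup_ge P (fun t => (mxnorm (A k t))%:E).
apply: filterS => t h; rewrite -lee_fin fineK //; apply: le_trans h _.
by apply: ereal_sup_ubound; exists k.
Qed.

Lemma bounded_mx_mul n m (A : nat -> T -> 'M[R]_(n, m)) a k (X : T -> 'cV[R]_m) :
  bounded_mx A a -> L2v P (past w k) X ->
  L2v P (past w k) (fun t => A k t *m X t) /\
  ip P (fun t => A k t *m X t) (fun t => A k t *m X t) <= a ^+ 2 * ip P X X.
Proof.
move=> [a0 pA Aa] [mX sX].
have [sAX AX] := sqint_mulmx (fun i j => measurable_wrtW (@pastT k) (pA k i j)) (Aa k) sX.
by split=> //; split=> //; exact: measurable_mx_mul.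
Qed.

Lemma bounded_mx_trmx n m (A : nat -> T -> 'M[R]_(n, m)) a :
  bounded_mx A a -> bounded_mx (fun k t => (A k t)^T) a.
Proof.
move=> [a0 pA Aa]; split=> //; first by move=> k; exact: measurable_mx_trmx.
move=> k; apply: filterS (Aa k) => t; rewrite /mxnorm trmxK => h.
by rewrite mxtrace_mulC.
Qed.

Lemma L2p_mul n m (A : nat -> T -> 'M[R]_(n, m)) a (X : nat -> T -> 'cV[R]_m) :
  bounded_mx A a -> L2p P w rho X ->
  L2p P w rho (fun k t => A k t *m X k t) /\
  IP P rho (fun k t => A k t *m X k t) (fun k t => A k t *m X k t) <=
    a ^+ 2 * IP P rho X X.
Proof.
move=> bA LX; apply: L2p_dom => //; first exact: sqr_ge0.
- by move=> k; exact: (bounded_mx_mul bA (LX.1 k)).1.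
- by move=> k; exact: (bounded_mx_mul bA (LX.1 k)).2.
Qed.

Lemma L2v_past_mono n j k (X : T -> 'cV[R]_n) : (j <= k)%N ->
  L2v P (past w j) X -> L2v P (past w k) X.
Proof.
move=> jk [mX sX]; split=> // i l.
by apply: measurable_wrt_sub (mX i l); exact: past_mono.
Qed.

Lemma increment_L2v n k (X : T -> 'cV[R]_n) : L2v P (past w k) X ->
  L2v P (past w k.+1) (fun t => w k t *: X t).
Proof.
move=> LX; have [_ _ /(_ k) wv] := w_mds.
have [s _] := increment_isometry (@pastT k) (mw k) wv LX; split=> //.
move=> i j; rewrite /measurable_wrt; under eq_fun do rewrite mxE.
apply: measurable_funM; first exact: past_adapted.
by apply: measurable_wrt_sub (LX.1 i j); exact: past_mono.
Qed.

Definition step n m (F H : nat -> T -> 'M[R]_(n, m)) k (v : T -> 'cV[R]_m) :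
    T -> 'cV[R]_n :=
  fun t => F k t *m v t + w k t *: (H k t *m v t).

(** The drift and the diffusion parts are orthogonal, so the squares of the
    two operator bounds add up. *)
Lemma step_L2v n m (F H : nat -> T -> 'M[R]_(n, m)) f h k (v : T -> 'cV[R]_m) :
  bounded_mx F f -> bounded_mx H h -> L2v P (past w k) v ->
  L2v P (past w k.+1) (step F H k v) /\
  ip P (step F H k v) (step F H k v) <= (f ^+ 2 + h ^+ 2) * ip P v v.
Proof.
move=> bF bH Lv; have [_ /(_ k) wm /(_ k) wv] := w_mds.
have [LF Fle] := bounded_mx_mul bF Lv; have [LH Hle] := bounded_mx_mul bH Lv.
have LwH := increment_L2v LH.
have [_ iso] := increment_isometry (@pastT k) (mw k) wv LH.
have orth := increment_orthogonal (@pastT k) (mw k) wm wv LF LH.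
set X : T -> 'cV[R]_n := fun t => F k t *m v t in LF Fle orth *.
set Y : T -> 'cV[R]_n := fun t => w k t *: _ in LwH iso orth *.
have E : step F H k v = 1 *: X + Y by rewrite scale1r.
have LX := L2v_past_mono (leqnSn k) LF.
split; first by rewrite E; exact: L2v_lin.
rewrite E ip_linl ?(ipC _ _ (_ *: _ + _)) ?ip_linl //;
  try exact: (L2v_lin 1 LX LwH).2; try exact: LX.2; try exact: LwH.2.
by rewrite orth (ipC _ Y X) orth iso; lra.
Qed.

(** The effect at the next instant of the process [v] entering through the
    coefficients [F] and [H]; the state equation is [x = g + shift_step A C x]
    for a source [g]. *)
Definition shift_step n m (F H : nat -> T -> 'M[R]_(n, m))
    (v : nat -> T -> 'cV[R]_m) (k : nat) : T -> 'cV[R]_n :=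
  if k is j.+1 then step F H j (v j) else 0.

(** The adjoint of [shift_step F H], see [shift_duality]. Both the backward
    equation and the optimality condition of the Hamiltonian system are made of
    this operator, with [(A, C)] and [(B, D)] respectively. *)
Definition shift_adj n m (F H : nat -> T -> 'M[R]_(n, m))
    (y : nat -> T -> 'cV[R]_n) (k : nat) : T -> 'cV[R]_m :=
  fun t => expR (- rho) *: ((F k t)^T *m yprime P w y k t)
    + expR (- rho) *: ((H k t)^T *m zprime P w y k t).

Lemma step_lin n m (F H : nat -> T -> 'M[R]_(n, m)) k c u v :
  step F H k (c *: u + v) = c *: step F H k u + step F H k v.
Proof.
apply/funext => t; rewrite /step !fctE.
by rewrite !mulmxDr -!scalemxAr !scalerDr !scalerA (mulrC c) addrACA.
Qed.

Lemma shift_step_lin n m (F H : nat -> T -> 'M[R]_(n, m)) c u v :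
  shift_step F H (c *: u + v) = c *: shift_step F H u + shift_step F H v.
Proof.
apply/funext => -[|k]; last exact: step_lin.
change (0 = c *: (0 : T -> 'cV[R]_n) + 0).
by rewrite scaler0 addr0.
Qed.

Lemma shift_step_L2p n m (F H : nat -> T -> 'M[R]_(n, m)) f h v :
  bounded_mx F f -> bounded_mx H h -> L2p P w rho v ->
  L2p P w rho (shift_step F H v) /\
  IP P rho (shift_step F H v) (shift_step F H v) <=
    expR (- rho) * (f ^+ 2 + h ^+ 2) * IP P rho v v.
Proof.
move=> bF bH Lv.
have Lk k : L2v P (past w k) (shift_step F H v k).
  case: k => [|k]; first exact: L2v0.
  exact: (step_L2v bF bH (Lv.1 k)).1.
set c := expR (- rho) * (f ^+ 2 + h ^+ 2).
have c0 : 0 <= c by rewrite mulr_ge0 ?addr_ge0 ?sqr_ge0 // ltW // expR_gt0.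
have bnd N : \sum_(0 <= k < N) discount rho k *
    ip P (shift_step F H v k) (shift_step F H v k) <= c * IP P rho v v.
  case: N => [|N]; first by rewrite big_nil mulr_ge0 // (IP_ge0 Lv).
  rewrite big_nat_recl // ip0l mulr0 add0r.
  apply: (@le_trans _ _ (c * \sum_(0 <= k < N) discount rho k * ip P (v k) (v k))).
    rewrite mulr_sumr; apply: ler_sum => k _.
    have h1 := (step_L2v bF bH (Lv.1 k)).2.
    apply: le_trans (ler_wpM2l (discount_ge0 rho k.+1) h1) _.
    by rewrite discountS le_eqVlt; apply/orP; left; apply/eqP; rewrite /c; ring.
  by rewrite ler_wpM2l // (L2p_partial_le _ Lv).
have L : L2p P w rho (shift_step F H v) by split=> //; exists (c * IP P rho v v).
by split=> //; exact: IP_le_ub L bnd.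
Qed.

Lemma sqint_integrable_coord n (X : T -> 'cV[R]_n) i : sqint P X ->
  P.-integrable setT (fun t => (X t i ord0)%:E).
Proof.
move=> sX.
have := integrable_dotv sX (sqint_cst P (delta_mx i ord0)).
by apply: eq_integrable => // t _; rewrite dotv_delta.
Qed.

Lemma yprime_spec n (y : nat -> T -> 'cV[R]_n) k : sqint P (y k.+1) ->
  L2v P (past w k) (yprime P w y k) /\
  forall h, L2v P (past w k) h -> ip P (yprime P w y k) h = ip P (y k.+1) h.
Proof.
move=> sy; apply: (@condexp_mx_spec _ _ _ P _ (@pastT k) _ _ (ip P (y k.+1) (y k.+1))).
- by move=> i; exact: sqint_integrable_coord.
- by move=> h [_ sh]; exact: integrable_dotv.
- by move=> h [_ sh]; exact: ip_cauchy_schwarz.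
Qed.

(** The product [w k *: y k.+1] is only integrable, but it still defines a bounded
    functional on the vectors known at time [k], because multiplication by
    [w k] is isometric on them. *)
Lemma zprime_spec n (y : nat -> T -> 'cV[R]_n) k : sqint P (y k.+1) ->
  L2v P (past w k) (zprime P w y k) /\
  forall h, L2v P (past w k) h ->
    ip P (zprime P w y k) h = ip P (y k.+1) (fun t => w k t *: h t).
Proof.
move=> sy; have [_ _ /(_ k) wv] := w_mds.
pose F t := w k t *: y k.+1 t.
have E h : (fun t => dotv (F t) (h t)) = (fun t => dotv (y k.+1 t) (w k t *: h t)).
  by apply/funext => t; rewrite /F dotvZl dotvZr.
have iE h : ip P F h = ip P (y k.+1) (fun t => w k t *: h t) by rewrite /ip E.
have [|h Lh|h Lh|L spec] :=
    @condexp_mx_spec _ _ _ P _ (@pastT k) _ F (ip P (y k.+1) (y k.+1)).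
- move=> i.
  have L1 := L2v_cst P (past w k) (delta_mx i ord0 : 'cV[R]_n).
  have [s1 _] := increment_isometry (@pastT k) (mw k) wv L1.
  have := integrable_dotv sy s1; apply: eq_integrable => // t _.
  by rewrite dotvZr dotv_delta /F mxE.
- have [s1 _] := increment_isometry (@pastT k) (mw k) wv Lh.
  by have := integrable_dotv sy s1; apply: eq_integrable => // t _; rewrite /F dotvZl dotvZr.
- have [s1 iso] := increment_isometry (@pastT k) (mw k) wv Lh.
  by rewrite iE -iso; exact: ip_cauchy_schwarz.
- by split=> // h Lh; rewrite -iE; exact: spec.
Qed.

Lemma shift_adj_coord n m (F H : nat -> T -> 'M[R]_(n, m)) f h y k :
  bounded_mx F f -> bounded_mx H h -> sqint P (y k.+1) ->
  L2v P (past w k) (shift_adj F H y k) /\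
  forall v, L2v P (past w k) v -> ip P (shift_adj F H y k) v =
    expR (- rho) * ip P (y k.+1) (step F H k v).
Proof.
move=> bF bH sy.
have [Ly ys] := yprime_spec sy; have [Lz zs] := zprime_spec sy.
have [LF _] := bounded_mx_mul (bounded_mx_trmx bF) Ly.
have [LH _] := bounded_mx_mul (bounded_mx_trmx bH) Lz.
have LH' := L2vZ (expR (- rho)) LH.
have E : shift_adj F H y k =
    expR (- rho) *: (fun t => (F k t)^T *m yprime P w y k t)
    + (expR (- rho) *: (fun t => (H k t)^T *m zprime P w y k t)) by [].
split; first by rewrite E; exact: L2v_lin.
move=> v Lv; have [LFv _] := bounded_mx_mul bF Lv; have [LHv _] := bounded_mx_mul bH Lv.
have LwHv := increment_L2v LHv.
have adj (q p : nat) (A : T -> 'M[R]_(q, p)) X Y :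
    ip P (fun t => (A t)^T *m X t) Y = ip P X (fun t => A t *m Y t).
  by rewrite ip_adj; congr (ip P _ _); apply/funext => t; rewrite trmxK.
have eF := etrans (adj _ _ (F k) (yprime P w y k) v) (ys _ LFv).
have eH := etrans (adj _ _ (H k) (zprime P w y k) v) (zs _ LHv).
rewrite E (ip_linl _ LF.2 LH'.2 Lv.2) (ipZl _ LH.2 Lv.2) eF eH.
have -> : step F H k v = 1 *: (fun t => F k t *m v t) +
    (fun t => w k t *: (H k t *m v t)) by rewrite scale1r.
rewrite [in RHS]ipC (ip_linl _ LFv.2 LwHv.2 sy) mul1r mulrDr.
by rewrite (ipC _ _ (y k.+1)) (ipC _ _ (y k.+1)).
Qed.

(** Testing the defining identity of [shift_adj] against itself bounds its norm
    by that of [y]. *)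
Lemma shift_adj_L2p n m (F H : nat -> T -> 'M[R]_(n, m)) f h y :
  bounded_mx F f -> bounded_mx H h -> L2p P w rho y ->
  L2p P w rho (shift_adj F H y).
Proof.
move=> bF bH Ly.
have spec k := shift_adj_coord bF bH (L2p_sqint k.+1 Ly).
set c := expR (- rho) * (f ^+ 2 + h ^+ 2).
have c0 : 0 <= c by rewrite mulr_ge0 ?addr_ge0 ?sqr_ge0 // ltW // expR_gt0.
split; first by move=> k; have [] := spec k.
exists (c * IP P rho y y) => N.
apply: (@le_trans _ _ (c * \sum_(0 <= k < N.+1) discount rho k * ip P (y k) (y k))); last first.
  by rewrite ler_wpM2l // (L2p_partial_le _ Ly).
rewrite big_nat_recl // mulrDr.
have y0 : 0 <= c * (discount rho 0 * ip P (y 0%N) (y 0%N)).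
  by apply: mulr_ge0 => //; apply: mulr_ge0; [exact: discount_ge0|exact: ip_ge0].
apply: le_trans (_ : _ <= c * \sum_(0 <= k < N) discount rho k.+1 * ip P (y k.+1) (y k.+1)) _;
  last by rewrite lerDr.
rewrite mulr_sumr; apply: ler_sum => k _.
have [Lr rs] := spec k; set r := shift_adj F H y k in Lr rs *.
have [Ls sle] := step_L2v bF bH Lr.
have CS := ip_cauchy_schwarz (L2p_sqint k.+1 Ly) Ls.2.
have r0 := ip_ge0 P r; have rr := rs _ Lr.
set a := ip P r r in r0 rr sle *; set b := ip P (y k.+1) (y k.+1) in CS *.
have b0 : 0 <= b := ip_ge0 P (y k.+1).
have e0 : 0 < expR (- rho) by exact: expR_gt0.
have h1 : a * a <= expR (- rho) * c * b * a.
  rewrite -expr2 {1}rr exprMn /c.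
  apply: le_trans (ler_wpM2l (sqr_ge0 _) CS) _.
  rewrite (_ : _ * b * a = expR (- rho) ^+ 2 * (b * ((f ^+ 2 + h ^+ 2) * a))); last by ring.
  by rewrite ler_wpM2l ?sqr_ge0 // ler_wpM2l.
have h2 : a <= expR (- rho) * c * b.
  have [->|a0] := eqVneq a 0; first by apply: mulr_ge0 => //; apply: mulr_ge0 => //; exact: ltW.
  by rewrite -(@ler_pM2r _ a) // lt_neqAle eq_sym a0.
rewrite discountS; apply: le_trans (ler_wpM2l (discount_ge0 rho k) h2) _.
by rewrite le_eqVlt; apply/orP; left; apply/eqP; ring.
Qed.

(** Duality between the one-step dynamics and the conditional expectations of
    the adjoint equation, summed over time with the discount; the factor
    [expR (- rho)] in [shift_adj] absorbs the shift of the index. *)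
Lemma shift_duality n m (F H : nat -> T -> 'M[R]_(n, m)) f h y v :
  bounded_mx F f -> bounded_mx H h -> L2p P w rho y -> L2p P w rho v ->
  IP P rho y (shift_step F H v) = IP P rho (shift_adj F H y) v.
Proof.
move=> bF bH Ly Lv.
have La := shift_adj_L2p bF bH Ly.
apply/cvg_lim => //; rewrite -cvg_shiftS /=.
have := L2p_cvg La Lv; rewrite -/(IP P rho _ _).
rewrite (_ : (fun N => _ N.+1) =
  series (fun k => discount rho k * ip P (shift_adj F H y k) (v k))) //.
apply/funext => N; rewrite !seriesEnat /= big_nat_recl //.
rewrite (ipC _ _ 0) ip0l mulr0 add0r; apply: eq_bigr => k _.
rewrite (shift_adj_coord bF bH (L2p_sqint k.+1 Ly)).2; last exact: Lv.1.
by rewrite discountS; ring.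
Qed.

Fixpoint solution n (A C : nat -> T -> 'M[R]_n) (g : nat -> T -> 'cV[R]_n)
    (k : nat) : T -> 'cV[R]_n :=
  if k is j.+1 then step A C j (solution A C g j) + g j.+1 else g 0%N.

Section Solution.
Variables (n : nat) (A C : nat -> T -> 'M[R]_n) (a c : R).
Hypotheses (bA : bounded_mx A a) (bC : bounded_mx C c).
Hypothesis stable : 2 * (expR (- rho) * (a ^+ 2 + c ^+ 2)) <= 3^-1.
Implicit Types g y f : nat -> T -> 'cV[R]_n.

Lemma solutionE g : solution A C g = g + shift_step A C (solution A C g).
Proof.
apply/funext => -[|k]; last exact: addrC.
by change (g 0%N = g 0%N + 0); rewrite addr0.
Qed.

Lemma solution_unique g x : x = g + shift_step A C x -> x = solution A C g.
Proof.
move=> xE; apply/funext; elim=> [|k IH].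
  by rewrite xE; change (g 0%N + 0 = g 0%N); rewrite addr0.
rewrite xE; change (g k.+1 + step A C k (x k) = step A C k (solution A C g k) + g k.+1).
by rewrite IH addrC.
Qed.

Lemma solution_lin q g h :
  solution A C (q *: g + h) = q *: solution A C g + solution A C h.
Proof.
apply/esym/solution_unique; rewrite shift_step_lin addrACA -scalerDr.
by rewrite -!solutionE.
Qed.

(** The stability condition makes one step a contraction of factor at most
    [1/6] for the squared discounted norm, up to the factor [2] paid for
    separating the source. *)
Lemma solution_L2p g : L2p P w rho g -> L2p P w rho (solution A C g) /\
  IP P rho (solution A C g) (solution A C g) <= 3 * IP P rho g g.
Proof.
move=> Lg; set X := solution A C g.
have LX k : L2v P (past w k) (X k).
  elim: k => [|k IH]; first exact: Lg.1.
  rewrite (_ : X k.+1 = 1 *: step A C k (X k) + g k.+1); last by rewrite scale1r.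
  by apply: L2v_lin; [exact: (step_L2v bA bC IH).1|exact: Lg.1].
have e0 : 0 < expR (- rho) by exact: expR_gt0.
have S0 N : 0 <= \sum_(0 <= k < N) discount rho k * ip P (X k) (X k).
  by apply: sumr_ge0 => k _; rewrite mulr_ge0 ?discount_ge0 ?ip_ge0.
have stepX N : \sum_(0 <= k < N.+1) discount rho k * ip P (X k) (X k) <=
    3^-1 * (\sum_(0 <= k < N) discount rho k * ip P (X k) (X k)) +
    2 * (\sum_(0 <= k < N.+1) discount rho k * ip P (g k) (g k)).
  rewrite !big_nat_recl // mulrDr addrCA.
  apply: lerD.
    have := ip_ge0 P (g 0%N); rewrite discount0 !mul1r -[X 0%N]/(g 0%N); lra.
  rewrite !mulr_sumr -big_split /=; apply: ler_sum => k _.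
  have [Ls sle] := step_L2v bA bC (LX k).
  have sg := L2p_sqint k.+1 Lg.
  pose Y := step A C k (X k).
  have -> : X k.+1 = 1 *: Y + g k.+1 by rewrite scale1r.
  have s1 := sqint_lin 1 Ls.2 sg; have s2 := sqint_lin (-1) Ls.2 sg.
  have := ip_ge0 P (-1 *: Y + g k.+1).
  rewrite !ip_linl ?(ipC _ _ (_ *: _ + _)) ?ip_linl ?(ipC _ (g k.+1) Y) //;
    try exact: Ls.2.
  move: sle; rewrite -/Y; set p := ip P Y Y; set q := ip P (g k.+1) (g k.+1).
  set e := ip P Y _; set x := ip P (X k) (X k) => sle h0.
  have x0 : 0 <= x := ip_ge0 P (X k).
  have h1 : 1 * (1 * p + e) + (1 * e + q) <= 2 * ((a ^+ 2 + c ^+ 2) * x) + 2 * q by lra.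
  apply: le_trans (ler_wpM2l (discount_ge0 rho k.+1) h1) _.
  rewrite mulrDr [X in _ + X <= _]mulrCA lerD2r discountS.
  have -> : expR (- rho) * discount rho k * (2 * ((a ^+ 2 + c ^+ 2) * x)) =
     (2 * (expR (- rho) * (a ^+ 2 + c ^+ 2))) * (discount rho k * x) by ring.
  by rewrite ler_wpM2r // mulr_ge0 // discount_ge0.
have bndN N : \sum_(0 <= k < N) discount rho k * ip P (X k) (X k) <=
    3 * \sum_(0 <= k < N) discount rho k * ip P (g k) (g k).
  elim: N => [|N IH]; first by rewrite !big_nil mulr0.
  apply: le_trans (stepX N) _.
  have : \sum_(0 <= k < N) discount rho k * ip P (g k) (g k) <=
         \sum_(0 <= k < N.+1) discount rho k * ip P (g k) (g k).
    by rewrite [leRHS]big_nat_recr //= lerDl mulr_ge0 ?discount_ge0 ?ip_ge0.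
  by move: IH; lra.
have bnd N : \sum_(0 <= k < N) discount rho k * ip P (X k) (X k) <=
    3 * IP P rho g g.
  apply: le_trans (bndN N) _; rewrite ler_wpM2l // (L2p_partial_le _ Lg) //.
have L : L2p P w rho X by split=> //; exists (3 * IP P rho g g).
by split=> //; exact: IP_le_ub L bnd.
Qed.

(** The backward equation with driving term [f]. *)
Definition adjoint_equation f y : Prop :=
  forall k, ae_same P (y k) (fun t => shift_adj A C y k t + f k t).

Let dualB y x : L2p P w rho y -> L2p P w rho x ->
  IP P rho y (x - shift_step A C x) = IP P rho (y - shift_adj A C y) x.
Proof.
move=> Ly Lx; have [Ls _] := shift_step_L2p bA bC Lx.
have La := shift_adj_L2p bA bC Ly.
rewrite (IPC P rho y) (IPBl Lx Ls Ly) (IPBl Ly La Lx).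
by rewrite (IPC P rho _ y) (IPC P rho _ y) (shift_duality bA bC Ly Lx).
Qed.

(** In particular the pairing of a solution with every source is prescribed,
    which makes the solution unique. *)
Lemma adjoint_duality f y : L2p P w rho f -> L2p P w rho y ->
  adjoint_equation f y ->
  forall g, L2p P w rho g -> IP P rho y g = IP P rho f (solution A C g).
Proof.
move=> Lf Ly yE g Lg; have [LX _] := solution_L2p Lg.
have La := shift_adj_L2p bA bC Ly.
have gE : g = solution A C g - shift_step A C (solution A C g).
  by rewrite [X in _ = X - _]solutionE addrK.
transitivity (IP P rho y (solution A C g - shift_step A C (solution A C g))).
  by rewrite -gE.
rewrite (dualB Ly LX); apply: (IP_ae (L2pB Ly La) Lf LX).
move=> k; apply: filterS (yE k) => t E.
by rewrite !fctE E addrC addKr.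
Qed.

(** The adjoint equation is solved by transposition: its solution represents
    the functional [g |-> IP f (solution g)], and the equation is read off by
    testing against [x - shift_step x], whose solution is [x]. *)
Lemma adjoint_exists f : L2p P w rho f ->
  exists2 y, L2p P w rho y & adjoint_equation f y.
Proof.
move=> Lf.
have [y Ly yf] : exists2 y, L2p P w rho y &
    forall g, L2p P w rho g -> IP P rho y g = IP P rho f (solution A C g).
  apply: (@riesz_representation R _ (@L2p _ _ _ P w rho n) (@IP _ _ _ P rho n)
            (fun g => IP P rho f (solution A C g)) (3 * IP P rho f f)).
  - exact: L2p0.
  - by move=> q u v; exact: L2p_lin.
  - by move=> u v _ _; exact: IPC.
  - by move=> q u v h Lu Lv Lh; apply: IP_linl Lu Lv Lh.
  - by move=> u Lu; exact: IP_ge0 Lu.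
  - move=> s Ls sK; have [X LX XK] := L2p_complete mw ler01 Ls sK.
    by exists X => //; exists (2 * 1).
  - move=> q u v Lu Lv; rewrite solution_lin.
    exact: (IP_linr q (solution_L2p Lu).1 (solution_L2p Lv).1 Lf).
  - move=> g Lg; have [LX Xle] := solution_L2p Lg.
    apply: le_trans (IP_cauchy_schwarz Lf LX) _.
    by apply: le_trans (ler_wpM2l (IP_ge0 Lf) Xle) _; rewrite mulrCA mulrA lexx.
exists y => //.
have La := shift_adj_L2p bA bC Ly.
pose r := y - shift_adj A C y - f.
have Lya := L2pB Ly La; have Lr : L2p P w rho r by exact: L2pB.
have rr : IP P rho r r <= 0.
  have [Ls _] := shift_step_L2p bA bC Lr.
  have := yf _ (L2pB Lr Ls); rewrite (dualB Ly Lr) -(@solution_unique _ r).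
    by move=> E; rewrite {1}/r (IPBl Lya Lf Lr) E subrr.
  by rewrite subrK.
move=> k; apply: filterS (IP_eq0 Lr rr k) => t.
by rewrite /r !fctE => /eqP; rewrite subr_eq0 subr_eq addrC => /eqP.
Qed.

End Solution.

End LinearDynamics.

(** * Measurability of the inverse matrix *)

Section MeasurableInverse.
Context {d : measure_display} {T : measurableType d} {R : realType}.

Lemma measurable_funV (f : T -> R) : measurable_fun setT f ->
  measurable_fun setT (fun t => (f t)^-1).
Proof.
move=> mf.
(* The inverse as a real power of a nonnegative base; at a zero of [f] both
   sides vanish. *)
have -> : (fun t => (f t)^-1) = (fun t => f t * powR (f t ^+ 2) (-1)).
  apply/funext => t; rewrite powR_inv1 ?sqr_ge0 //.
  have [->|f0] := eqVneq (f t) 0; first by rewrite invr0 mul0r.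
  by rewrite expr2 invfM mulrA mulfV // mul1r.
apply: measurable_funM => //.
by apply: (measurableT_comp (measurable_powR _)); exact: measurable_funX.
Qed.

Lemma measurable_det n (A : T -> 'M[R]_n) :
  (forall i j, measurable_fun setT (fun t => A t i j)) ->
  measurable_fun setT (fun t => \det (A t)).
Proof.
move=> mA; rewrite /determinant; apply: measurable_sum => s.
by apply: measurable_funM => //; apply: measurable_prod => i _; exact: mA.
Qed.

Lemma measurable_invmx n (A : T -> 'M[R]_n) : (forall t, A t \in unitmx) ->
  (forall i j, measurable_fun setT (fun t => A t i j)) ->
  forall i j, measurable_fun setT (fun t => invmx (A t) i j).
Proof.
move=> uA mA i j.
under eq_fun do rewrite /invmx uA !mxE.
apply: measurable_funM.
  by apply: measurable_funV; exact: measurable_det.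
apply: measurable_funM => //; apply: measurable_det => k l.
by under eq_fun do rewrite !mxE; exact: mA.
Qed.

End MeasurableInverse.

(** * Weighted forms on processes *)

Section WeightedForms.
Context {d : measure_display} {T : measurableType d} {R : realType}.
Variables (P : probability T R) (w : nat -> T -> R) (rho : R).
Hypothesis w_mds : normalized_martingale_difference P w.

Definition mulp n m (S : nat -> T -> 'M[R]_(n, m)) (X : nat -> T -> 'cV[R]_m) :
  nat -> T -> 'cV[R]_n := fun k t => S k t *m X k t.

Lemma mulp_lin n m (S : nat -> T -> 'M[R]_(n, m)) c X Y :
  mulp S (c *: X + Y) = c *: mulp S X + mulp S Y.
Proof.
by apply/funext => k; apply/funext => t; rewrite /mulp !fctE mulmxDr -scalemxAr.
Qed.

Lemma IP_ge0_coord n (g h : nat -> T -> 'cV[R]_n) : L2p P w rho g ->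
  L2p P w rho h -> (forall k t, 0 <= dotv (g k t) (h k t)) ->
  0 <= IP P rho g h.
Proof.
move=> Lg Lh gh; apply: limr_ge; first exact: L2p_cvg Lg Lh.
apply: nearW => N; rewrite seriesEnat; apply: sumr_ge0 => k _.
by rewrite mulr_ge0 ?discount_ge0 // Rintegral_ge0.
Qed.

Lemma IP_mulp_sym n (S : nat -> T -> 'M[R]_n) X Y :
  (forall k t, S k t \is symmetricmx) ->
  IP P rho (mulp S X) Y = IP P rho (mulp S Y) X.
Proof.
move=> Ssym; rewrite /IP; congr (limn (series _)); apply/funext => k.
congr (_ * _); rewrite /ip; apply: eq_Rintegral => t _; exact: dotv_sym.
Qed.

Lemma le_of_sqr_le (s x y : R) : 0 <= s -> 0 <= x ->
  y ^+ 2 <= s ^+ 2 * x * x -> y <= s * x.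
Proof.
move=> s0 x0 h; have sx := mulr_ge0 s0 x0.
have [y0|y0] := leP y 0; first exact: le_trans sx.
by rewrite -(@ler_pXn2r _ 2) ?nnegrE // ?exprMn ?(expr2 x) ?mulrA // ltW.
Qed.

Lemma IP_mulp_le n (S : nat -> T -> 'M[R]_n) s X :
  bounded_mx P w S s -> L2p P w rho X ->
  IP P rho (mulp S X) X <= s * IP P rho X X.
Proof.
move=> bS LX; have [s0 _ _] := bS.
have [LSX SXle] := L2p_mul w_mds bS LX.
have X0 := IP_ge0 LX.
have CS := IP_cauchy_schwarz LSX LX.
apply: (le_of_sqr_le s0 X0); apply: (le_trans CS).
exact: (ler_wpM2r X0 SXle).
Qed.

Lemma IP_mulp_coercive n (S : nat -> T -> 'M[R]_n) s delta X :
  bounded_mx P w S s ->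
  (forall k t, nonneg_definite (S k t - delta%:M)) -> L2p P w rho X ->
  delta * IP P rho X X <= IP P rho (mulp S X) X.
Proof.
move=> bS Sd LX; have [LSX _] := L2p_mul w_mds bS LX.
rewrite -/(mulp S X) in LSX.
have : 0 <= IP P rho (- delta *: X + mulp S X) X.
  apply: (IP_ge0_coord (L2p_lin _ LX LSX) LX) => k t.
  have := coercive_ge (X k t) (Sd k t).
  rewrite (_ : (- delta *: X + mulp S X) k t = - delta *: X k t + S k t *m X k t) //.
  by rewrite dotvDl dotvZl mulNr [_ + dotv _ _]addrC subr_ge0.
by rewrite (IP_linl _ LX LSX LX) mulNr [_ + IP _ _ _ _]addrC subr_ge0.
Qed.

Lemma IP_mulp_ge0 n (S : nat -> T -> 'M[R]_n) s X : bounded_mx P w S s ->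
  (forall k t, nonneg_definite (S k t)) -> L2p P w rho X ->
  0 <= IP P rho (mulp S X) X.
Proof.
move=> bS S0 LX; have [LSX _] := L2p_mul w_mds bS LX.
by apply: IP_ge0_coord => // k t; exact: S0.
Qed.

Definition at_start n (X : T -> 'cV[R]_n) (k : nat) : T -> 'cV[R]_n :=
  if k is 0%N then X else 0.

Lemma at_start_lin n c (X Y : T -> 'cV[R]_n) :
  at_start (c *: X + Y) = c *: at_start X + at_start Y.
Proof.
apply/funext => -[|k] //; change (0 = c *: (0 : T -> 'cV[R]_n) + 0).
by rewrite scaler0 addr0.
Qed.

Lemma at_start_L2p n (X : T -> 'cV[R]_n) : L2v P (past w 0) X ->
  L2p P w rho (at_start X) /\ IP P rho (at_start X) (at_start X) <= ip P X X.
Proof.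
move=> LX.
have bnd N : \sum_(0 <= k < N) discount rho k *
    ip P (at_start X k) (at_start X k) <= ip P X X.
  case: N => [|N]; first by rewrite big_nil ip_ge0.
  rewrite big_nat_recl // big1 ?addr0 ?discount0 ?mul1r // => k _.
  by rewrite ip0l mulr0.
have L : L2p P w rho (at_start X).
  by split; [case=> [//|k]; exact: L2v0|exists (ip P X X)].
by split=> //; exact: IP_le_ub L bnd.
Qed.

Lemma IP_at_start n (y : nat -> T -> 'cV[R]_n) X :
  IP P rho y (at_start X) = ip P (y 0%N) X.
Proof.
apply/cvg_lim => //; rewrite -cvg_shiftS /=.
rewrite (_ : (fun N => _ N.+1) = cst (ip P (y 0%N) X)); first exact: cvg_cst.
apply/funext => N; rewrite seriesEnat /= big_nat_recl // discount0 mul1r.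
by rewrite big1 ?addr0 // => k _; rewrite ipC ip0l mulr0.
Qed.

End WeightedForms.

(** * The control problem *)

(* Inner products are the unknowns of the linear identities that follow. *)
Ltac forms_lra :=
  repeat match goal with
  | |- context [IP ?p ?z ?x ?y] => generalize (IP p z x y)
  | |- context [ip ?p ?x ?y] => generalize (ip p x y)
  end; intros; lra.

Section ControlProblem.
Context {d : measure_display} {T : measurableType d} {R : realType}.
Variables (P : probability T R) (w : nat -> T -> R) (rho : R).
Hypothesis w_mds : normalized_martingale_difference P w.
Variables (n m : nat) (dat : flq_data T R n m).
Variables (a b c e q r delta : R).

Local Notation A := (lqA dat).
Local Notation B := (lqB dat).
Local Notation C := (lqC dat).
Local Notation D := (lqD dat).
Local Notation M := (lqM dat).
Local Notation Q := (lqQ dat).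
Local Notation S := (lqR dat).

Hypotheses (bA : bounded_mx P w A a) (bB : bounded_mx P w B b).
Hypotheses (bC : bounded_mx P w C c) (bD : bounded_mx P w D e).
Hypotheses (bQ : bounded_mx P w Q q) (bS : bounded_mx P w S r).
Hypotheses (Lb : L2p P w rho (lqb dat)) (Ls : L2p P w rho (lqsigma dat)).
Hypotheses (Msym : M \is symmetricmx) (Mpos : pos_definite M).
Hypotheses (Qsym : forall k t, Q k t \is symmetricmx)
           (Qnn : forall k t, nonneg_definite (Q k t)).
Hypotheses (Ssym : forall k t, S k t \is symmetricmx) (delta0 : 0 < delta)
           (Sd : forall k t, nonneg_definite (S k t - delta%:M)).
Hypothesis stable : 2 * (expR (- rho) * (a ^+ 2 + c ^+ 2)) <= 3^-1.

Let mw : forall k, measurable_fun setT (w k).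
Proof. by case: w_mds. Qed.

Let pastT k : <<s past w k >> `<=` measurable := past_measurable mw.

Local Notation plan := ((T -> 'cV[R]_n) * (nat -> T -> 'cV[R]_m))%type.
Implicit Types p s : plan.

Definition adm p := L2v P (past w 0) p.1 /\ L2p P w rho p.2.

Definition plan_norm p : R := ip P p.1 p.1 + IP P rho p.2 p.2.

Definition source p : nat -> T -> 'cV[R]_n :=
  at_start p.1 + shift_step w B D p.2.

Definition resp p := solution w A C (source p).

(** The inhomogeneous terms, written with the identity and zero coefficients so
    that they are sources of the same kind as the controls. *)
Definition forcing : nat -> T -> 'cV[R]_n :=
  shift_step w (fun _ _ => 1%:M) (fun _ _ => 0) (lqb dat) +
  shift_step w (fun _ _ => 0) (fun _ _ => 1%:M) (lqsigma dat).

Lemma bounded_mx_cst k (N : 'M[R]_k) : bounded_mx P w (fun _ _ => N) (mxnorm N).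
Proof.
split; first exact: mxnorm_ge0.
- by move=> l i j; exact: measurable_cst.
- by move=> l; apply: nearW => t; exact: lexx.
Qed.

Lemma forcing_L2p : L2p P w rho forcing.
Proof.
have L1 := (shift_step_L2p w_mds (bounded_mx_cst 1%:M) (bounded_mx_cst 0) Lb).1.
have L2 := (shift_step_L2p w_mds (bounded_mx_cst 0) (bounded_mx_cst 1%:M) Ls).1.
by have := L2p_lin 1 L1 L2; rewrite scale1r.
Qed.

Lemma state_eq p :
  state w dat p.1 p.2 = resp p + solution w A C forcing.
Proof.
rewrite -[resp p]scale1r -solution_lin scale1r; apply/funext.
elim=> [|k IH].
  change (p.1 = (p.1 + 0) + (0 + 0)).
  by rewrite !addr0.
change (next_state w dat k (state w dat p.1 p.2 k) (p.2 k) =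
  step w A C k (solution w A C (source p + forcing) k) +
  ((0 + step w B D k (p.2 k)) + (step w (fun _ _ => 1%:M) (fun _ _ => 0) k (lqb dat k)
   + step w (fun _ _ => 0) (fun _ _ => 1%:M) k (lqsigma dat k)))).
rewrite add0r -IH; apply/funext => t.
set x := state w dat p.1 p.2 k.
change (A k t *m x t + B k t *m p.2 k t + lqb dat k t
    + w k t *: (C k t *m x t + D k t *m p.2 k t + lqsigma dat k t) =
  (A k t *m x t + w k t *: (C k t *m x t)) +
  ((B k t *m p.2 k t + w k t *: (D k t *m p.2 k t)) +
   ((1%:M *m lqb dat k t + w k t *: (0 *m lqb dat k t)) +
    (0 *m lqsigma dat k t + w k t *: (1%:M *m lqsigma dat k t))))).
rewrite !mul1mx !mul0mx scaler0 addr0 add0r !scalerDr.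
set x1 := A k t *m x t; set x2 := B k t *m _; set x3 := lqb dat k t.
set y1 := w k t *: (C k t *m x t); set y2 := w k t *: (D k t *m _).
set y3 := w k t *: _.
by rewrite [RHS]addrA [in RHS](addrACA x1 y1) [RHS]addrACA.
Qed.

Lemma source_lin z p s : source (z *: p + s) = z *: source p + source s.
Proof.
rewrite /source -[(z *: p + s).1]/(z *: p.1 + s.1) at_start_lin.
rewrite -[(z *: p + s).2]/(z *: p.2 + s.2) shift_step_lin.
by rewrite addrACA -scalerDr.
Qed.

Lemma resp_lin z p s : resp (z *: p + s) = z *: resp p + resp s.
Proof. by rewrite /resp source_lin solution_lin. Qed.

Lemma adm_lin z p s : adm p -> adm s -> adm (z *: p + s).
Proof.
move=> [p1 p2] [s1 s2]; split; first exact: (L2v_lin z p1 s1).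
exact: (L2p_lin z p2 s2).
Qed.

Lemma adm0 : adm (0 : plan).
Proof. by split; [exact: L2v0|exact: L2p0]. Qed.

Lemma adm_sub p s : adm p -> adm s -> adm (p - s).
Proof. by move=> ap as_; rewrite addrC -scaleN1r; exact: adm_lin. Qed.

Lemma IP_add_le k (g h : nat -> T -> 'cV[R]_k) : L2p P w rho g ->
  L2p P w rho h ->
  IP P rho (g + h) (g + h) <= 2 * IP P rho g g + 2 * IP P rho h h.
Proof.
move=> Lg Lh.
have quad z : IP P rho (z *: g + h) (z *: g + h) =
    z * (z * IP P rho g g + IP P rho g h) + (z * IP P rho g h + IP P rho h h).
  have Lz := L2p_lin z Lg Lh.
  rewrite (IP_linl z Lg Lh Lz) (IP_linr z Lg Lh Lg) (IP_linr z Lg Lh Lh).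
  by rewrite (IPC P rho h g).
have := quad 1; have := quad (-1); rewrite scale1r => E1 E2.
have := IP_ge0 (L2p_lin (-1) Lg Lh).
rewrite {}E2 {}E1.
move: (IP P rho g g) (IP P rho g h) (IP P rho h h) => x y z; lra.
Qed.

Let chi : R := 6 * (1 + expR (- rho) * (b ^+ 2 + e ^+ 2)).

Let gain_ge0 : 0 <= expR (- rho) * (b ^+ 2 + e ^+ 2).
Proof. by apply: mulr_ge0; [exact: ltW (expR_gt0 _)|rewrite addr_ge0 ?sqr_ge0]. Qed.

Lemma source_L2p p : adm p -> L2p P w rho (source p).
Proof.
move=> [p1 p2].
have L1 := (at_start_L2p rho p1).1.
have L2 := (shift_step_L2p w_mds bB bD p2).1.
by have := L2p_lin 1 L1 L2; rewrite scale1r.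
Qed.

Lemma resp_L2p p : adm p -> L2p P w rho (resp p) /\
  IP P rho (resp p) (resp p) <= chi * plan_norm p.
Proof.
move=> ap; have [p1 p2] := ap.
have [L1 le1] := at_start_L2p rho p1.
have [L2 le2] := shift_step_L2p w_mds bB bD p2.
have [Lr ler] := solution_L2p w_mds bA bC stable (source_L2p ap).
split=> //; apply: (le_trans ler); rewrite /chi /plan_norm.
have := IP_add_le L1 L2; rewrite -/(source p).
have h1 := ip_ge0 P p.1; have h2 := IP_ge0 p2; have g0 := gain_ge0.
move: le1 le2 h1 h2 g0.
move: (ip P p.1 p.1) (IP P rho p.2 p.2) (expR (- rho) * _) => x y g.
move: (IP P rho (source p) (source p)) (IP P rho (at_start _) _) (IP P rho (shift_step _ _ _ _) _).
move=> z1 z2 z3 le1 le2 x0 y0 g0 le3.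
have := mulr_ge0 g0 x0; nra.
Qed.

Definition mulM (X : T -> 'cV[R]_n) : T -> 'cV[R]_n := fun t => M *m X t.

Lemma mulM_lin z X Y : mulM (z *: X + Y) = z *: mulM X + mulM Y.
Proof. by apply/funext => t; rewrite /mulM !fctE mulmxDr -scalemxAr. Qed.

Lemma mulM_L2v X : L2v P (past w 0) X -> L2v P (past w 0) (mulM X).
Proof. by move=> LX; exact: (bounded_mx_mul w_mds (bounded_mx_cst M) LX).1. Qed.

Lemma mulM_sym X Y : ip P (mulM X) Y = ip P (mulM Y) X.
Proof. by apply: eq_Rintegral => t _; exact: dotv_sym. Qed.

Lemma mulM_ge0 X : 0 <= ip P (mulM X) X.
Proof. by apply: Rintegral_ge0 => t _; exact: pos_definite_ge0. Qed.

Lemma mulM_le X : L2v P (past w 0) X -> ip P (mulM X) X <= mxnorm M * ip P X X.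
Proof.
move=> LX; have [LM le] := bounded_mx_mul w_mds (bounded_mx_cst M) LX.
have X0 := ip_ge0 P X.
have CS := ip_cauchy_schwarz LM.2 LX.2.
apply: (le_of_sqr_le (mxnorm_ge0 M) X0); apply: (le_trans CS).
exact: (ler_wpM2r X0 le).
Qed.

Lemma mulM_coercive X : L2v P (past w 0) X ->
  ip P X X <= mxnorm (invmx M) * ip P (mulM X) X.
Proof.
move=> LX; have iM := integrable_dotv (mulM_L2v LX).2 LX.2.
have iX := integrable_dotv LX.2 LX.2.
rewrite /ip -RintegralZl //; apply: le_Rintegral => //.
  have := integrableZl measurableT (mxnorm (invmx M)) iM.
  by apply: eq_integrable => // t _; rewrite -EFinM.
by move=> t _; exact: pos_definite_coercive.
Qed.

(** Second variation of the cost. *)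
Definition energy p s : R :=
  ip P (mulM p.1) s.1 + IP P rho (mulp Q (resp p)) (resp s)
  + IP P rho (mulp S p.2) s.2.

Lemma mulpQ_L2p p : adm p -> L2p P w rho (mulp Q (resp p)).
Proof. by move=> ap; exact: (L2p_mul w_mds bQ (resp_L2p ap).1).1. Qed.

Lemma mulpS_L2p p : adm p -> L2p P w rho (mulp S p.2).
Proof. by move=> [_ p2]; exact: (L2p_mul w_mds bS p2).1. Qed.

Lemma energyC p s : energy p s = energy s p.
Proof.
have eQ := IP_mulp_sym P rho (resp p) (resp s) Qsym.
have eS := IP_mulp_sym P rho p.2 s.2 Ssym.
by rewrite /energy (mulM_sym p.1 s.1) eQ eS.
Qed.

Lemma energy_linl z p s u : adm p -> adm s -> adm u ->
  energy (z *: p + s) u = z * energy p u + energy s u.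
Proof.
move=> ap as_ au.
have e1 : mulM (z *: p + s).1 = z *: mulM p.1 + mulM s.1 by exact: mulM_lin.
have e2 : mulp Q (resp (z *: p + s)) = z *: mulp Q (resp p) + mulp Q (resp s).
  by rewrite resp_lin mulp_lin.
have e3 : mulp S (z *: p + s).2 = z *: mulp S p.2 + mulp S s.2 by exact: mulp_lin.
rewrite /energy e1 e2 e3.
rewrite (ip_linl z (mulM_L2v ap.1).2 (mulM_L2v as_.1).2 au.1.2).
rewrite (IP_linl z (mulpQ_L2p ap) (mulpQ_L2p as_) (resp_L2p au).1).
rewrite (IP_linl z (mulpS_L2p ap) (mulpS_L2p as_) au.2).
move: (ip P (mulM p.1) _) (ip P (mulM s.1) _) (IP P rho (mulp Q (resp p)) _)
  (IP P rho (mulp Q (resp s)) _) (IP P rho (mulp S p.2) _) (IP P rho (mulp S s.2) _).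
by move=> *; ring.
Qed.

Let kappa : R := mxnorm (invmx M) + delta^-1.

Let kappa_ge0 : 0 <= kappa.
Proof. by rewrite addr_ge0 ?mxnorm_ge0 // invr_ge0 ltW. Qed.

Lemma energy_parts_ge0 p : adm p -> [/\ 0 <= ip P (mulM p.1) p.1,
  0 <= IP P rho (mulp Q (resp p)) (resp p) & 0 <= IP P rho (mulp S p.2) p.2].
Proof.
move=> ap; split; first exact: mulM_ge0.
- exact: (IP_mulp_ge0 w_mds bQ Qnn (resp_L2p ap).1).
- apply: le_trans (IP_mulp_coercive w_mds bS Sd ap.2).
  by apply: mulr_ge0; [exact: ltW|exact: IP_ge0 ap.2].
Qed.

Lemma energy_ge0 p : adm p -> 0 <= energy p p.
Proof. by move=> /energy_parts_ge0[]; rewrite /energy; forms_lra. Qed.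

Lemma plan_norm_le_energy p : adm p -> plan_norm p <= kappa * energy p p.
Proof.
move=> ap; have [h1 h2 h3] := energy_parts_ge0 ap.
have := mulM_coercive ap.1; have := IP_mulp_coercive w_mds bS Sd ap.2.
rewrite mulrC -ler_pdivlMr // /plan_norm /energy /kappa.
have d1 : 0 <= delta^-1 by rewrite invr_ge0 ltW.
have m0 := mxnorm_ge0 (invmx M).
move: h1 h2 h3 d1 m0.
move: (ip P p.1 p.1) (IP P rho p.2 p.2) (ip P (mulM _) _) (IP P rho (mulp Q _) _)
  (IP P rho (mulp S _) _) (delta^-1) (mxnorm _).
move=> x y x' z y' dd k h1 h2 h3 d1 m0 le2 le1.
have := mulr_ge0 d1 h1; have := mulr_ge0 d1 h2; have := mulr_ge0 m0 h2.
have := mulr_ge0 m0 h3; lra.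
Qed.

Let lam : R := mxnorm M + q * chi + r.

Lemma energy_le_plan_norm p : adm p -> energy p p <= lam * plan_norm p.
Proof.
move=> ap; have [Lr ler] := resp_L2p ap.
have := mulM_le ap.1; have := IP_mulp_le w_mds bQ Lr; have := IP_mulp_le w_mds bS ap.2.
have [q0 _ _] := bQ; have [r0 _ _] := bS; have m0 := mxnorm_ge0 M.
have := ler_wpM2l q0 ler.
have x0 := ip_ge0 P p.1; have y0 := IP_ge0 ap.2.
rewrite /energy /lam /plan_norm; move: x0 y0 q0 r0 m0.
move: (ip P p.1 p.1) (IP P rho p.2 p.2) (ip P (mulM _) _) (IP P rho (mulp Q _) _)
  (IP P rho (mulp S _) _) (IP P rho (resp p) _) (mxnorm M) chi.
move=> x y x' z y' z' k ch x0 y0 q0 r0 m0 h1 h2 h3 h4.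
have := mulr_ge0 m0 y0; have := mulr_ge0 r0 x0; lra.
Qed.

Lemma plan_norm_ae0 p : adm p -> plan_norm p <= 0 ->
  ae_same P p.1 (fun=> 0) /\ forall k, ae_same P (p.2 k) (fun=> 0).
Proof.
move=> [p1 p2]; rewrite /plan_norm.
have h1 := ip_ge0 P p.1; have h2 := IP_ge0 p2 => h.
have [x0 y0] : ip P p.1 p.1 = 0 /\ IP P rho p.2 p.2 <= 0.
  by move: h1 h2 h; move: (ip _ _ _) (IP _ _ _ _) => x y *; split; lra.
by split; [exact: (ip_eq0 p1.2)|exact: (IP_eq0 p2)].
Qed.

(** The energy is equivalent to [plan_norm]: bounded above by boundedness of the
    weights and of [resp], below by coercivity of [M] and [S]. *)
Lemma energy_complete (s : nat -> plan) : (forall i, adm (s i)) ->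
  (forall i j, (i <= j)%N -> energy (s i - s j) (s i - s j) <= 1 / 4 ^+ i) ->
  exists2 p, adm p & exists K, forall i,
    energy (s i - p) (s i - p) <= K / 4 ^+ i.
Proof.
move=> as_ sC.
have nC i j : (i <= j)%N -> plan_norm (s i - s j) <= kappa / 4 ^+ i.
  move=> ij; apply: (le_trans (plan_norm_le_energy (adm_sub (as_ i) (as_ j)))).
  by apply: (le_trans (ler_wpM2l kappa_ge0 (sC _ _ ij))); rewrite mul1r.
have [|i j ij|xi Lxi xiC] :=
    @L2v_complete _ _ _ P _ (@pastT 0) n (fun i => (s i).1) kappa kappa_ge0.
- by move=> i; exact: (as_ i).1.
- apply: le_trans (nC _ _ ij); rewrite /plan_norm -[(s i - s j).1]/((s i).1 - (s j).1).
  by rewrite lerDl; exact: (IP_ge0 (adm_sub (as_ i) (as_ j)).2).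
have [|i j ij|u Lu uC] :=
    @L2p_complete _ _ _ P w rho mw m (fun i => (s i).2) kappa kappa_ge0.
- by move=> i; exact: (as_ i).2.
- apply: le_trans (nC _ _ ij); rewrite /plan_norm -[(s i - s j).2]/((s i).2 - (s j).2).
  by rewrite lerDr; exact: ip_ge0.
have ap : adm (xi, u) by split.
exists (xi, u) => //; exists (lam * (n%:R * kappa + 2 * kappa)) => i.
apply: (le_trans (energy_le_plan_norm (adm_sub (as_ i) ap))).
rewrite -mulrA; apply: ler_wpM2l.
  have [q0 _ _] := bQ; have [r0 _ _] := bS.
  rewrite /lam addr_ge0 // addr_ge0 ?mxnorm_ge0 // mulr_ge0 //.
  by rewrite /chi mulr_ge0 // addr_ge0.
by rewrite mulrDl; apply: lerD; [exact: xiC|exact: uC].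
Qed.

Local Notation st p := (state w dat p.1 p.2).

Lemma state_L2p p : adm p -> L2p P w rho (st p).
Proof.
move=> ap; rewrite state_eq -[resp p]scale1r.
apply: L2p_lin; first exact: (resp_L2p ap).1.
exact: (solution_L2p w_mds bA bC stable forcing_L2p).1.
Qed.

Lemma mulpQ_state_L2p p : adm p -> L2p P w rho (mulp Q (st p)).
Proof. by move=> ap; exact: (L2p_mul w_mds bQ (state_L2p ap)).1. Qed.

(** The first variation of the cost at [p] vanishes. *)
Definition stationary p : Prop := forall s, adm s ->
  ip P (mulM p.1) s.1 + IP P rho (mulp Q (st p)) (resp s)
  + IP P rho (mulp S p.2) s.2 = 0.

(** Stationarity at [p] is a linear equation: [energy p] has to represent the
    contribution of the response [x0] to the inhomogeneous terms. *)
Lemma stationary_exists : exists2 p, adm p & stationary p.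
Proof.
pose x0 := solution w A C forcing.
have Lx0 : L2p P w rho x0 by exact: (solution_L2p w_mds bA bC stable forcing_L2p).1.
have LQx0 : L2p P w rho (mulp Q x0) by exact: (L2p_mul w_mds bQ Lx0).1.
pose l (p : plan) : R := - IP P rho (mulp Q x0) (resp p).
have [p ap pl] : exists2 p, adm p & forall s, adm s -> energy p s = l s.
  apply: (@riesz_representation R _ adm energy l
      (IP P rho (mulp Q x0) (mulp Q x0) * (chi * kappa))).
  - exact: adm0.
  - by move=> z u v; exact: adm_lin.
  - by move=> u v _ _; exact: energyC.
  - by move=> z u v h; exact: energy_linl.
  - by move=> u; exact: energy_ge0.
  - exact: energy_complete.
  - move=> z u v au av; rewrite /l resp_lin.
    by rewrite (IP_linr z (resp_L2p au).1 (resp_L2p av).1 LQx0) opprD mulrN.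
  - move=> v av; have [Lr ler] := resp_L2p av; rewrite /l sqrrN.
    apply: (le_trans (IP_cauchy_schwarz LQx0 Lr)); rewrite -mulrA.
    apply: (ler_wpM2l (IP_ge0 LQx0)); apply: (le_trans ler).
    rewrite -mulrA; apply: ler_wpM2l (plan_norm_le_energy av).
    by rewrite /chi mulr_ge0 // addr_ge0.
exists p => // s as_; have := pl _ as_; rewrite /l /energy => E.
have [Lr _] := resp_L2p as_.
rewrite state_eq -/x0 -[resp p]scale1r mulp_lin (IP_linl 1 (mulpQ_L2p ap) LQx0 Lr).
by move: E => {pl}; forms_lra.
Qed.

Lemma state_sub p p' : st p - st p' = resp (p - p').
Proof.
rewrite !state_eq opprD addrACA subrr addr0.
have -> : p - p' = -1 *: p' + p by rewrite scaleN1r addrC.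
by rewrite resp_lin scaleN1r addrC.
Qed.

(** The difference of two stationary plans has no energy. *)
Lemma stationary_unique p p' : adm p -> adm p' ->
  stationary p -> stationary p' ->
  ae_same P p.1 p'.1 /\ forall k, ae_same P (p.2 k) (p'.2 k).
Proof.
move=> ap ap' sp sp'.
pose dd : plan := p - p'; have ad : adm dd := adm_sub ap ap'.
have [Lr _] := resp_L2p ad.
have h1 : ip P (mulM dd.1) dd.1 = ip P (mulM p.1) dd.1 - ip P (mulM p'.1) dd.1.
  have := ip_linl (-1) (mulM_L2v ap'.1).2 (mulM_L2v ap.1).2 ad.1.2.
  by rewrite -mulM_lin scaleN1r addrC mulN1r (addrC (- _)).
have h2 : IP P rho (mulp Q (resp dd)) (resp dd) =
    IP P rho (mulp Q (st p)) (resp dd) - IP P rho (mulp Q (st p')) (resp dd).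
  have := IP_linl (-1) (mulpQ_state_L2p ap') (mulpQ_state_L2p ap) Lr.
  by rewrite -mulp_lin scaleN1r addrC state_sub mulN1r (addrC (- _)).
have h3 : IP P rho (mulp S dd.2) dd.2 =
    IP P rho (mulp S p.2) dd.2 - IP P rho (mulp S p'.2) dd.2.
  have := IP_linl (-1) (mulpS_L2p ap') (mulpS_L2p ap) ad.2.
  by rewrite -mulp_lin scaleN1r addrC mulN1r (addrC (- _)).
have dd0 : energy dd dd = 0.
  move: (sp _ ad) (sp' _ ad); rewrite /energy h1 h2 h3 {h1 h2 h3}.
  by forms_lra.
have n0 : plan_norm dd <= 0.
  by apply: (le_trans (plan_norm_le_energy ad)); rewrite dd0 mulr0.
have [z1 z2] := plan_norm_ae0 ad n0; split.
  by apply: filterS z1 => t /eqP; rewrite subr_eq0 => /eqP.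
by move=> k; apply: filterS (z2 k) => t /eqP; rewrite subr_eq0 => /eqP.
Qed.

Lemma state_ae p p' : ae_same P p.1 p'.1 ->
  (forall k, ae_same P (p.2 k) (p'.2 k)) ->
  forall k, ae_same P (st p k) (st p' k).
Proof.
move=> h1 h2; elim=> [//|k IH].
by apply: filterS2 IH (h2 k) => t E1 E2; rewrite /= /next_state E1 E2.
Qed.

Local Notation rad y := (shift_adj P w rho B D y).

Lemma rad_L2p y : L2p P w rho y -> L2p P w rho (rad y).
Proof. by move=> Ly; exact: (shift_adj_L2p w_mds bB bD Ly). Qed.

Definition plan_of (y : nat -> T -> 'cV[R]_n) : plan :=
  (xi_bar dat y, u_bar P w rho dat y).

Lemma u_bar_optimality y k t :
  S k t *m (plan_of y).2 k t = - rad y k t.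
Proof.
by rewrite /plan_of /u_bar /= mulmxN mulKVmx // (coercive_unitmx delta0 (Sd k t)).
Qed.

Lemma xi_bar_optimality y : mulM (plan_of y).1 = - y 0%N.
Proof.
apply/funext => t; rewrite /mulM /plan_of /xi_bar /= mulmxN mulKVmx //.
exact: pos_definite_unitmx.
Qed.

Lemma plan_of_adm y : L2p P w rho y -> adm (plan_of y).
Proof.
move=> Ly; have Lr := rad_L2p Ly; split.
  have := (bounded_mx_mul w_mds (bounded_mx_cst (invmx M)) (Ly.1 0%N)).1.
  move=> /(L2vZ (-1)); congr (L2v _ _ _).
  by apply/funext => t; rewrite !fctE scaleN1r.
have inv_meas G k : measurable_mx G (S k) -> measurable_mx G (fun t => invmx (S k t)).
  move=> mS; apply: (@measurable_invmx _ (g_sigma_algebraType G)) mS => t.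
  exact: (coercive_unitmx delta0 (Sd k t)).
have mu k : measurable_mx (past w k) (u_bar P w rho dat y k).
  have [_ pS _] := bS.
  have mX := measurable_mx_mul (inv_meas _ _ (pS k)) (Lr.1 k).1.
  have := measurable_mx_lin (-1) mX (L2v0 P (past w k) m).1.
  congr (measurable_mx _ _); apply/funext => t.
  by rewrite !fctE addr0 scaleN1r.
have bnd k : sqint P (u_bar P w rho dat y k) /\
    ip P (u_bar P w rho dat y k) (u_bar P w rho dat y k) <=
    delta ^- 2 * ip P (rad y k) (rad y k).
  apply: (sqint_dom (L2p_sqint k Lr)).
  - by move=> i j; exact: (measurable_wrtW (@pastT k) (mu k i j)).
  - by rewrite invr_ge0 sqr_ge0.
  - apply: nearW => t; rewrite /u_bar dotvNl dotvNr opprK.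
    exact: (coercive_inv_le _ delta0 (Sd k t)).
apply: (L2p_dom (c := delta ^- 2) Lr _ _ _).1; first by rewrite invr_ge0 sqr_ge0.
- by move=> k; split; [exact: mu|have [] := bnd k].
- by move=> k; have [] := bnd k.
Qed.

(** Along the homogeneous response to a plan, the adjoint process turns the
    running cost of the state into a cost of the plan. *)
Lemma first_variation x y s : L2p P w rho x -> L2p P w rho y ->
  adjoint_equation P w rho A C (mulp Q x) y -> adm s ->
  IP P rho (mulp Q x) (resp s) = ip P (y 0%N) s.1 + IP P rho (rad y) s.2.
Proof.
move=> Lx Ly yE as_.
have LQx : L2p P w rho (mulp Q x) by exact: (L2p_mul w_mds bQ Lx).1.
rewrite -(adjoint_duality w_mds bA bC stable LQx Ly yE (source_L2p as_)).
have L1 := (at_start_L2p rho as_.1).1.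
have L2 := (shift_step_L2p w_mds bB bD as_.2).1.
have := IP_linr 1 L1 L2 Ly; rewrite scale1r mul1r -/(source s) => ->.
by rewrite IP_at_start (shift_duality w_mds bB bD Ly as_.2).
Qed.

Lemma adjoint_equation_ae f f' y : (forall k, ae_same P (f k) (f' k)) ->
  adjoint_equation P w rho A C f y -> adjoint_equation P w rho A C f' y.
Proof. by move=> ff' yE k; apply: filterS2 (yE k) (ff' k) => t -> ->. Qed.

(** The equations of the Hamiltonian system determine its control and state from
    its adjoint process alone, up to null sets; with [first_variation] they say
    that the corresponding plan is stationary. *)
Lemma hamiltonian_stationary x u y : L2p P w rho x -> L2p P w rho y ->
  hamiltonian_system P w rho dat x u y ->
  [/\ forall k, ae_same P (x k) (st (plan_of y) k),
      adjoint_equation P w rho A C (mulp Q (st (plan_of y))) y &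
      stationary (plan_of y)].
Proof.
move=> Lx Ly [xE yE x0 uE].
have uu k : ae_same P (u k) (u_bar P w rho dat y k).
  apply: filterS (uE k) => t /esym/eqP; rewrite addrC addr_eq0 => /eqP h.
  rewrite /u_bar -mulmxN -[X in invmx _ *m X]h mulKmx //.
  exact: (coercive_unitmx delta0 (Sd k t)).
have xx k : ae_same P (x k) (st (plan_of y) k).
  elim: k => [|k IH]; first exact: x0.
  apply: ae_same_trans (xE k) _.
  by apply: filterS2 IH (uu k) => t E1 E2; rewrite /= /next_state E1 E2.
have ap := plan_of_adm Ly.
have yE' : adjoint_equation P w rho A C (mulp Q (st (plan_of y))) y.
  apply: (@adjoint_equation_ae (mulp Q x)); last exact: yE.
  by move=> k; apply: filterS (xx k) => t E; rewrite /mulp E.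
split=> // s as_.
rewrite (first_variation (state_L2p ap) Ly yE' as_) xi_bar_optimality.
have -> : mulp S (plan_of y).2 = - rad y.
  by apply/funext => k; apply/funext => t; exact: u_bar_optimality.
have Ly0 := Ly.1 0%N; have Lr := rad_L2p Ly.
have := ipZl (-1) Ly0.2 as_.1.2; have := IP_linl (-1) Lr (L2p0 P w rho m) as_.2.
rewrite scaleN1r addr0 scaleN1r => -> ->.
have -> : IP P rho (0 : nat -> T -> 'cV[R]_m) s.2 = 0.
  have := IP_linl 1 (L2p0 P w rho m) (L2p0 P w rho m) as_.2.
  by rewrite scale1r addr0; forms_lra.
by forms_lra.
Qed.

Lemma hamiltonian_exists : exists x y, [/\ L2p P w rho x, L2p P w rho y &
  hamiltonian_system P w rho dat x (u_bar P w rho dat y) y].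
Proof.
have [p ap ps] := stationary_exists.
have Lx := state_L2p ap.
have LQx := mulpQ_state_L2p ap.
have [y Ly yE] := adjoint_exists w_mds bA bC stable LQx.
have Lr := rad_L2p Ly.
(* The residuals of the two optimality conditions, tested against themselves. *)
pose z : plan := (1 *: mulM p.1 + y 0%N, 1 *: mulp S p.2 + rad y).
have LM := mulM_L2v ap.1; have LS := mulpS_L2p ap.
have az : adm z by split; [exact: (L2v_lin 1 LM (Ly.1 0%N))|exact: (L2p_lin 1 LS Lr)].
have z0 : plan_norm z <= 0.
  have n1 : ip P z.1 z.1 = ip P (mulM p.1) z.1 + ip P (y 0%N) z.1.
    by have := ip_linl 1 LM.2 (Ly.1 0%N).2 az.1.2; rewrite mul1r.
  have n2 : IP P rho z.2 z.2 = IP P rho (mulp S p.2) z.2 + IP P rho (rad y) z.2.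
    by have := IP_linl 1 LS Lr az.2; rewrite mul1r.
  have := ps _ az; rewrite (first_variation Lx Ly yE az) /plan_norm n1 n2 {n1 n2}.
  by forms_lra.
have [z1 z2] := plan_norm_ae0 az z0.
have pxi : ae_same P p.1 (plan_of y).1.
  apply: filterS z1 => t; rewrite /z /= scale1r !fctE /mulM => /eqP.
  rewrite addr_eq0 => /eqP h; rewrite /xi_bar -mulmxN -h mulKmx //.
  exact: pos_definite_unitmx.
have pu k : ae_same P (p.2 k) ((plan_of y).2 k).
  apply: filterS (z2 k) => t; rewrite /z /= scale1r !fctE /mulp => /eqP.
  rewrite addr_eq0 => /eqP h; rewrite /u_bar -mulmxN -h mulKmx //.
  exact: (coercive_unitmx delta0 (Sd k t)).
have xx := state_ae pxi pu.
exists (st (plan_of y)), y; split=> //; first exact: state_L2p (plan_of_adm Ly).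
split.
- by move=> k; apply: ae_sameS.
- move=> k; apply: filterS2 (yE k) (xx k) => t -> h.
  by rewrite /mulp h.
- exact: ae_sameS.
- move=> k; apply: ae_sameS => t.
  have := u_bar_optimality y k t; rewrite /plan_of /= => ->.
  by rewrite -/(rad y k t) subrr.
Qed.

Lemma adjoint_unique f f' y y' : L2p P w rho f -> L2p P w rho f' ->
  L2p P w rho y -> L2p P w rho y' -> (forall k, ae_same P (f k) (f' k)) ->
  adjoint_equation P w rho A C f y -> adjoint_equation P w rho A C f' y' ->
  forall k, ae_same P (y k) (y' k).
Proof.
move=> Lf Lf' Ly Ly' ff' yE yE'.
have yE2 := adjoint_equation_ae ff' yE.
have Ld := L2pB Ly Ly'.
have d0 : IP P rho (y - y') (y - y') <= 0.
  rewrite (IPBl Ly Ly' Ld) (adjoint_duality w_mds bA bC stable Lf' Ly yE2 Ld).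
  by rewrite (adjoint_duality w_mds bA bC stable Lf' Ly' yE' Ld) subrr.
move=> k; apply: filterS (IP_eq0 Ld d0 k) => t /eqP.
by rewrite subr_eq0 => /eqP.
Qed.

Lemma hamiltonian_unique x u y x' u' y' : L2p P w rho x -> L2p P w rho y ->
  L2p P w rho x' -> L2p P w rho y' ->
  hamiltonian_system P w rho dat x u y ->
  hamiltonian_system P w rho dat x' u' y' ->
  forall k, ae_same P (x' k) (x k) /\ ae_same P (y' k) (y k).
Proof.
move=> Lx Ly Lx' Ly' H H'.
have [xx yE sp] := hamiltonian_stationary Lx Ly H.
have [xx' yE' sp'] := hamiltonian_stationary Lx' Ly' H'.
have ap := plan_of_adm Ly; have ap' := plan_of_adm Ly'.
have [e1 e2] := stationary_unique ap' ap sp' sp.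
have ss := state_ae e1 e2.
move=> k; split.
  apply: ae_same_trans (xx' k) _; apply: ae_same_trans (ss k) _.
  exact: ae_same_sym.
apply: (adjoint_unique (mulpQ_state_L2p ap') (mulpQ_state_L2p ap) Ly' Ly _ yE' yE).
by move=> l; apply: filterS (ss l) => t E; exact: (congr1 (mulmx (Q l t)) E).
Qed.

Definition real_cost p : R := 2^-1 * (ip P (mulM p.1) p.1
  + IP P rho (mulp Q (st p)) (st p) + IP P rho (mulp S p.2) p.2).

Lemma integral_series_IP k (g h : nat -> T -> 'cV[R]_k) :
  L2p P w rho g -> L2p P w rho h -> (forall l t, 0 <= dotv (g l t) (h l t)) ->
  (\sum_(0 <= l <oo) \int[P]_t (discount rho l * dotv (g l t) (h l t))%:E =
   (IP P rho g h)%:E)%E.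
Proof.
move=> Lg Lh gh0; rewrite /IP -EFin_lim; last exact: (L2p_cvg Lg Lh).
congr (limn _); apply/funext => N; rewrite /= seriesEnat /= -sumEFin.
apply: eq_bigr => l _; under eq_integral do rewrite EFinM.
have il := integrable_dotv (L2p_sqint l Lg) (L2p_sqint l Lh).
rewrite (integralZl measurableT il) EFinM /ip /Rintegral fineK //.
exact: (integrable_fin_num measurableT il).
Qed.

Lemma costE p : adm p -> cost P w rho dat p.1 p.2 = (real_cost p)%:E.
Proof.
move=> ap; have Lx := state_L2p ap; have LQ := mulpQ_state_L2p ap.
have LS := mulpS_L2p ap; have LM := mulM_L2v ap.1.
have iM := integrable_dotv LM.2 ap.1.2.
have Q0 l t : 0 <= dotv (mulp Q (st p) l t) (st p l t) by exact: Qnn.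
have S0 l t : 0 <= dotv (mulp S p.2 l t) (p.2 l t).
  apply: le_trans (coercive_ge _ (Sd l t)).
  by apply: mulr_ge0; [exact: ltW|exact: dotv_ge0].
have M0 t : 0 <= dotv (mulM p.1 t) (p.1 t) by exact: pos_definite_ge0.
have meas k (g h : nat -> T -> 'cV[R]_k) l : L2p P w rho g -> L2p P w rho h ->
    measurable_fun setT (fun t => (discount rho l * dotv (g l t) (h l t))%:E).
  move=> Lg Lh; apply/measurable_EFinP; apply: measurable_funM.
    exact: measurable_cst.
  exact: measurable_dotv (L2p_sqint l Lg).1 (L2p_sqint l Lh).1.
pose F l t := ((discount rho l * dotv (mulp Q (st p) l t) (st p l t))%:E +
               (discount rho l * dotv (mulp S p.2 l t) (p.2 l t))%:E)%E.
have F0 l t : (0 <= F l t)%E.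
  by rewrite /F -EFinD lee_fin addr_ge0 // mulr_ge0 ?discount_ge0.
have mF l : measurable_fun setT (F l).
  exact: (emeasurable_funD (meas _ _ _ l LQ Lx) (meas _ _ _ l LS ap.2)).
rewrite /cost /real_cost EFinM; congr (_ * _)%E.
transitivity (\int[P]_t ((dotv (mulM p.1 t) (p.1 t))%:E +
    \sum_(0 <= l <oo) F l t))%E.
  apply: eq_integral => t _; congr (_ + _)%E; apply: eq_eseriesr => l _.
  by rewrite /F -EFinD -mulrDr.
rewrite ge0_integralD //; last 4 first.
- by move=> t _; rewrite lee_fin.
- exact: (measurable_int P iM).
- by move=> t _; apply: nneseries_ge0 => l _ _.
- by apply: ge0_emeasurable_sum => // l t _ _.
rewrite integral_nneseries //.
have -> : (\sum_(0 <= l <oo) \int[P]_t F l t =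
   \sum_(0 <= l <oo) (\int[P]_t (discount rho l * dotv (mulp Q (st p) l t) (st p l t))%:E
     + \int[P]_t (discount rho l * dotv (mulp S p.2 l t) (p.2 l t))%:E))%E.
  apply: eq_eseriesr => l _; rewrite ge0_integralD //.
  - by move=> t _; rewrite lee_fin mulr_ge0 ?discount_ge0.
  - exact: (meas _ _ _ l LQ Lx).
  - by move=> t _; rewrite lee_fin mulr_ge0 ?discount_ge0.
  - exact: (meas _ _ _ l LS ap.2).
rewrite nneseriesD; last 2 first.
- by move=> l _ _; apply: integral_ge0 => t _; rewrite lee_fin mulr_ge0 ?discount_ge0.
- by move=> l _ _; apply: integral_ge0 => t _; rewrite lee_fin mulr_ge0 ?discount_ge0.
rewrite (integral_series_IP LQ Lx Q0) (integral_series_IP LS ap.2 S0).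
rewrite !EFinD addeA; congr (_ + _ + _)%E.
by rewrite /ip /Rintegral fineK //; exact: (integrable_fin_num measurableT iM).
Qed.

Lemma sym_form_expand (V : lmodType R) (L : V -> Prop) (f : V -> V -> R) x y :
  (forall u v, L u -> L v -> f u v = f v u) ->
  (forall z u v h, L u -> L v -> L h -> f (z *: u + v) h = z * f u h + f v h) ->
  L x -> L y -> L (1 *: y + x) ->
  f (1 *: y + x) (1 *: y + x) = f x x + 2 * f x y + f y y.
Proof.
move=> fC fl Lx Ly Lxy.
rewrite fl // (fC y _ Ly Lxy) (fC x _ Lx Lxy) !fl // (fC y x Ly Lx); lra.
Qed.

(** The cost is quadratic with second variation [energy], so at a stationary
    plan only the second-order term survives. *)
Lemma cost_expansion p p' : adm p -> adm p' -> stationary p ->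
  real_cost p' = real_cost p + 2^-1 * energy (p' - p) (p' - p).
Proof.
move=> ap ap' sp.
pose dd : plan := p' - p; have ad : adm dd := adm_sub ap' ap.
have [Lr _] := resp_L2p ad.
have E1 : 1 *: dd.1 + p.1 = p'.1 by rewrite scale1r /= subrK.
have E2 : 1 *: dd.2 + p.2 = p'.2 by rewrite scale1r /= subrK.
have E3 : 1 *: resp dd + st p = st p' by rewrite scale1r -state_sub subrK.
have h1 : ip P (mulM (1 *: dd.1 + p.1)) (1 *: dd.1 + p.1) = ip P (mulM p.1) p.1
    + 2 * ip P (mulM p.1) dd.1 + ip P (mulM dd.1) dd.1 :=
  @sym_form_expand _ (L2v P (past w 0) (n := n))
  (fun X Y => ip P (mulM X) Y) p.1 dd.1 (fun u v _ _ => mulM_sym u v)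
  (fun z u v h Lu Lv Lh => etrans (congr1 (fun X => ip P X h) (mulM_lin z u v))
     (ip_linl z (mulM_L2v Lu).2 (mulM_L2v Lv).2 Lh.2))
  ap.1 ad.1 (L2v_lin 1 ad.1 ap.1).
rewrite E1 in h1.
have form k (N : nat -> T -> 'M[R]_k) (z : R) (X Y : nat -> T -> 'cV[R]_k) :
    bounded_mx P w N z -> (forall l t, N l t \is symmetricmx) ->
    L2p P w rho X -> L2p P w rho Y ->
    IP P rho (mulp N (1 *: Y + X)) (1 *: Y + X) = IP P rho (mulp N X) X
    + 2 * IP P rho (mulp N X) Y + IP P rho (mulp N Y) Y.
  move=> bN Nsym LX LY.
  apply: (@sym_form_expand _ (L2p P w rho (n := k)) (fun X Y => IP P rho (mulp N X) Y)).
  - by move=> u v _ _; exact: IP_mulp_sym.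
  - move=> z' u v h Lu Lv Lh; rewrite mulp_lin.
    exact: IP_linl (L2p_mul w_mds bN Lu).1 (L2p_mul w_mds bN Lv).1 Lh.
  - exact: LX.
  - exact: LY.
  - exact: L2p_lin LY LX.
have h2 := form _ _ _ _ _ bQ Qsym (state_L2p ap) Lr; rewrite E3 in h2.
have h3 := form _ _ _ _ _ bS Ssym ap.2 ad.2; rewrite E2 in h3.
have := sp _ ad.
by rewrite /real_cost -/dd h1 h2 h3 /energy {E1 E2 E3 h1 h2 h3}; forms_lra.
Qed.

Lemma stationary_optimal p p' : adm p -> adm p' -> stationary p ->
  (cost P w rho dat p.1 p.2 <= cost P w rho dat p'.1 p'.2)%E.
Proof.
move=> ap ap' sp; rewrite (costE ap) (costE ap') lee_fin (cost_expansion ap ap' sp).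
by rewrite lerDl mulr_ge0 // (energy_ge0 (adm_sub ap' ap)).
Qed.

Lemma optimal_unique p p' : adm p -> adm p' -> stationary p ->
  (cost P w rho dat p'.1 p'.2 <= cost P w rho dat p.1 p.2)%E ->
  ae_same P p'.1 p.1 /\ forall k, ae_same P (p'.2 k) (p.2 k).
Proof.
move=> ap ap' sp; rewrite (costE ap) (costE ap') lee_fin (cost_expansion ap ap' sp).
have ad := adm_sub ap' ap; have e0 := energy_ge0 ad => h.
have E : energy (p' - p) (p' - p) = 0 by lra.
have n0 : plan_norm (p' - p) <= 0.
  by apply: (le_trans (plan_norm_le_energy ad)); rewrite E mulr0.
have [h1 h2] := plan_norm_ae0 ad n0; split.
  by apply: filterS h1 => t /eqP; rewrite subr_eq0 => /eqP.
by move=> k; apply: filterS (h2 k) => t /eqP; rewrite subr_eq0 => /eqP.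
Qed.

Lemma admissibleP p : admissible P w rho p.1 p.2 <-> adm p.
Proof.
split=> [[[mxi xioo] Lu]|[[mxi sxi] Lu]].
  split; last exact/(L2rhoP P rho mw).
  have mxi' i j : measurable_fun setT (fun t => p.1 t i j).
    exact: (measurable_wrtW (@pastT 0) (mxi i j)).
  split=> //; split=> //; apply/integrableP; split.
    by apply/measurable_EFinP; exact: measurable_dotv.
  under eq_integral do rewrite gee0_abs ?lee_fin ?dotv_ge0 // -mxnorm_sqr_cV.
  exact: xioo.
split; last exact/(L2rhoP P rho mw).
split=> //; have [_ /integrableP[_]] := sxi.
under eq_integral do rewrite gee0_abs ?lee_fin ?dotv_ge0 // -mxnorm_sqr_cV.
exact.
Qed.

End ControlProblem.

(** * Optimality and the Hamiltonian system *)

Lemma stable_of_rate (R : realType) (rho a c : R) : 0 <= a -> 0 <= c ->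
  (lne (6%:E * (a%:E + c%:E) ^+ 2) < rho%:E)%E ->
  2 * (expR (- rho) * (a ^+ 2 + c ^+ 2)) <= 3^-1.
Proof.
move=> a0 c0; rewrite -EFinD -EFin_expe -EFinM.
have ac0 : 0 <= a * c by exact: mulr_ge0.
have e0 : 0 < expR (- rho) := expR_gt0 _.
(* If [a + c] vanishes, the logarithm is [-oo] and carries no information, but
   then [a] and [c] vanish too. *)
have [z|z] := eqVneq (6 * (a + c) ^+ 2) 0.
  have := sqr_ge0 a; have := sqr_ge0 c; have : a ^+ 2 + c ^+ 2 <= 0 by nra.
  move: (expR _) e0 => x x0 *; nra.
have z0 : 0 < 6 * (a + c) ^+ 2 by rewrite lt_neqAle eq_sym z mulr_ge0 ?sqr_ge0.
rewrite lne_EFin // lte_fin -ltr_expR lnK ?posrE // => h.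
have : expR (- rho) * (6 * (a + c) ^+ 2) <= 1.
  rewrite expRN mulrC ler_pdivrMr ?expR_gt0 // mul1r; exact: ltW.
have : expR (- rho) * (a ^+ 2 + c ^+ 2) <= expR (- rho) * (a + c) ^+ 2.
  by rewrite ler_pM2l // sqrrD; lra.
lra.
Qed.

Theorem theorem4p1 (R : realType) (d : measure_display) (T : measurableType d)
  (P : probability T R) (P_complete : measure_is_complete P)
  (w : nat -> T -> R) (w_mds : normalized_martingale_difference P w)
  (rho : R) (n m : nat) (dat : flq_data T R n m)
  (data_adm : flq_admissible_data P w rho dat)
  (M_pos : pos_definite (lqM dat))
  (Q_nonneg : forall k t, nonneg_definite (lqQ dat k t))
  (Q0 : forall t, lqQ dat 0%N t = 0)
  (R_coercive : exists2 delta : R, 0 < delta &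
     forall k t, nonneg_definite (lqR dat k t - delta%:M))
  (rho_large : (lne (6%:E * (Linf_norm P (lqA dat) + Linf_norm P (lqC dat)) ^+ 2)
                < rho%:E)%E) :
  exists x y : nat -> T -> 'cV[R]_n,
    [/\ N2rho P w rho x y,
        hamiltonian_system P w rho dat x (u_bar P w rho dat y) y,
        forall x' u' y', N2rho P w rho x' y' ->
          hamiltonian_system P w rho dat x' u' y' ->
          forall k, ae_same P (x' k) (x k) /\ ae_same P (y' k) (y k),
        flq_optimal P w rho dat (xi_bar dat y) (u_bar P w rho dat y) &
        forall xi u, flq_optimal P w rho dat xi u ->
          ae_same P xi (xi_bar dat y) /\
          forall k, ae_same P (u k) (u_bar P w rho dat y k)].
Proof.
have [mw _ _] := w_mds.
have [[LA LC LB LD] [Lb Ls] Msym [LQ Qsym] [LR Rsym]] := data_adm.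
have [delta delta0 Rd] := R_coercive.
have [bA EA] := Linf_bounded LA; have [bC EC] := Linf_bounded LC.
have [bB _] := Linf_bounded LB; have [bD _] := Linf_bounded LD.
have [bQ _] := Linf_bounded LQ; have [bR _] := Linf_bounded LR.
have L2P k (g : nat -> T -> 'cV[R]_k) := L2rhoP P rho mw g.
move/L2P: Lb => Lb; move/L2P: Ls => Ls.
have stable : 2 * (expR (- rho) * (fine (Linf_norm P (lqA dat)) ^+ 2 +
    fine (Linf_norm P (lqC dat)) ^+ 2)) <= 3^-1.
  have [a0 _ _] := bA; have [c0 _ _] := bC.
  by rewrite -EA -EC in rho_large; exact: stable_of_rate a0 c0 rho_large.
have [x [y [Lx Ly H]]] := hamiltonian_exists w_mds bA bB bC bD bQ bR Lb Ls
  Msym M_pos Qsym Q_nonneg Rsym delta0 Rd stable.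
have [_ _ sp] := hamiltonian_stationary w_mds bA bB bC bD bQ bR Lb Ls
  M_pos delta0 Rd stable Lx Ly H.
have ap := plan_of_adm w_mds bB bD bR delta0 Rd Ly.
have adP (p : (T -> 'cV[R]_n) * (nat -> T -> 'cV[R]_m)) :
  admissible P w rho p.1 p.2 <-> adm P w rho p := admissibleP rho w_mds p.
exists x, y; split=> //.
- by split; exact/L2P.
- move=> x' u' y' [/L2P Lx' /L2P Ly'] H'.
  exact: (hamiltonian_unique w_mds bA bB bC bD bQ bR Lb Ls
    Msym M_pos Q_nonneg delta0 Rd stable Lx Ly Lx' Ly' H H').
- split; first exact/(adP (plan_of P w rho dat y)).
  move=> xi u /(adP (xi, u)) ap'.
  exact: (stationary_optimal w_mds bA bB bC bD bQ bR Lb Ls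
    Msym M_pos Qsym Q_nonneg Rsym delta0 Rd stable ap ap' sp).
- move=> xi u [/(adP (xi, u)) ap' opt].
  apply: (optimal_unique w_mds bA bB bC bD bQ bR Lb Ls
    Msym M_pos Qsym Q_nonneg Rsym delta0 Rd stable ap ap' sp).
  by apply: opt; exact/(adP (plan_of P w rho dat y)).
Qed.
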